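(* Let $z>0$ and consider the optimization problem $$\textbf{minimize } J(\psi)\quad\textbf{subject to }\ \psi\in L^+[0,1]\ \text{ and }\ \int_0^1\psi(s)\,ds=z. \qquad (P)$$ Let $\psi^*$ be an optimal solution of (P), and let $T_0$, $T_1$, $T_0^0$ be the times associated with $\psi^*$ as defined in the context. Suppose that $T_0^0<T_1$. Then the left derivative of $\psi^*$ at $T_1$ satisfies $$\frac{d}{dt}^-\psi^*(t)\Big|_{t=T_1}=-\delta,$$ and $b=\lambda^*T_1$, where $b\in\mathbb{R}$ and $\lambda^*>0$ are the constants for which $\nabla I(\dot\psi^*(t))=b-\lambda^*t$ for all $T_0^0<t<T_1$.
   Context: $D[0,1]$ is the space of real-valued càdlàg functions on $[0,1]$ with the Skorohod $J_1$ topology; $L[0,1]\subset D[0,1]$ is the set of functions of finite variation; $L^+[0,1]$ is the set of non-negative elements of $L[0,1]$. Each $\phi\in L[0,1]$ has a Lebesgue decomposition $\phi(t)=\int_0^t\dot\phi^{(a)}(s)\,ds+\phi^{(s)}(t)$ into absolutely continuous and singular parts (so $\phi^{(s)}(0)=\phi(0)$; a value $\phi(0)\neq0$ counts as a jump at $0$), and $\phi^{(s)}=\phi^{\uparrow}-\phi^{\downarrow}$ is its Hahn decomposition into positive part $\phi^{\uparrow}$ and negative part $\phi^{\downarrow}$, both non-negative and non-decreasing. Standing assumptions. $\{X_n\}_{n\ge0}$ is a real-valued process; the scaled paths $x^n(t)=\frac1n\sum_{i=0}^{\lfloor nt\rfloor-1}X_i$ satisfy the large deviation principle in $D[0,1]$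 with good rate function $$I_X(\gamma)=\int_0^1 I(\dot\gamma^{(a)}(s))\,ds+\theta^{\downarrow}\gamma^{\downarrow}(1)+\theta^{\uparrow}\gamma^{\uparrow}(1)\ \text{ if }\gamma\in L[0,1],\qquad I_X(\gamma)=+\infty\ \text{ otherwise.}$$ Here, with $\Lambda_X(\theta)=\lim_n n^{-1}\log\mathsf{E}[\exp(\theta(X_0+\cdots+X_{n-1}))]$ (equal to $\log\mathsf{E}[e^{\theta X_0}]$ in the i.i.d. case), $I(y)=\sup_\theta(\theta y-\Lambda_X(\theta))$, $\theta^{\downarrow}=\sup\{\theta>0:\Lambda_X(-\theta)<\infty\}$, $\theta^{\uparrow}=\sup\{\theta>0:\Lambda_X(\theta)<\infty\}$, both in $(0,\infty]$. Moreover $I$ is a good, convex rate function and there exists $\delta>0$ with $I(-\delta)=0$; this is the $\delta$ in the claim. $\nabla I$ denotes the derivative of $I$. The objective function is $$J(\psi)=\int_0^1\left(I(\dot\psi^{(a)}(s))1_{\{\psi(s)>0\}}+\inf_{y\le0}I(y)\,1_{\{\psi(s)=0\}}\right)ds+\theta^{\downarrow}\psi^{\downarrow}(1)+\theta^{\uparrow}\psi^{\uparrow}(1),$$ with the convention $\infty\cdot0=0$ in the last two terms. Let $\bar r=\sup\{r:I(r)<\infty\}$. For a path $\psi$, $T_0=\inf\{t\ge0:\psi(t)>0\}$, $T_1=\sup\{t\le1:\psi(t)>0\}$. If $0<\bar r<\infty$, $T_0^0=\sup\{t\ge0:\frac{d}{dt}^-\psi(t)=\bar r\}$, where $\frac{d}{dt}^-$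 is the left derivative; if this set is empty (in particular if $\bar r=\infty$), $T_0^0=T_0$. When $T_0^0<T_1$, it is known that for every optimal $\psi^*$ there exist constants $b\in\mathbb{R}$, $\lambda^*>0$ with $\nabla I(\dot\psi^*(t))=b-\lambda^*t$ on $(T_0^0,T_1)$.
   Formalization: δ is taken to be the least positive number with I(−δ)=0 (automatic if the zero is unique; if I vanishes on an interval the claim fails for any other δ), and an optimal solution is required to have finite objective J. *)

(* Defs.v *)
From HB Require Import structures.
From mathcomp Require Import all_boot all_order all_algebra.
From mathcomp Require Import all_classical all_reals all_analysis.
Import Order.TTheory GRing.Theory Num.Theory numFieldNormedType.Exports.

Set Implicit Arguments.
Unset Strict Implicit.
Unset Printing Implicit Defensive.

Local Open Scope classical_set_scope.
Local Open Scope ring_scope.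
Local Open Scope ereal_scope.

(** Paths on [0,1] are functions [R -> R] of which only the values on [0,1]
    matter. *)

Section paths.
Context {R : realType}.
Implicit Types x y phi psi : R -> R.

Definition cadlag x : Prop :=
  (forall t : R, (0 <= t < 1)%R -> x s @[s --> t^'+] --> x t) /\
  (forall t : R, (0 < t <= 1)%R -> cvg (x s @[s --> t^'-])).

(** The set L[0,1]. *)
Definition finite_variation phi : Prop :=
  cadlag phi /\ bounded_variation 0%R 1%R phi.

(** The set L^+[0,1]. *)
Definition finite_variation_pos phi : Prop :=
  finite_variation phi /\ forall t : R, (0 <= t <= 1)%R -> (0 <= phi t)%R.

Definition time_change (u : R -> R) : Prop :=
  {in `[0%R, 1%R] &, {homo u : s t / (s < t)%R}} /\
  u @` [set` `[0%R, 1%R]] = [set` `[0%R, 1%R]].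

Definition J1_close (e : R) x y : Prop :=
  exists2 u, time_change u &
    forall t : R, (0 <= t <= 1)%R ->
      (`|u t - t| < e)%R /\ (`|x t - y (u t)| < e)%R.

Definition is_left_derivative psi (t v : R) : Prop :=
  (h^-1 * (psi (t + h) - psi t))%R @[h --> (0%R : R)^'-] --> v.

End paths.

Record skorohod (R : realType) := Skorohod {
  path_fun :> R -> R ;
  path_cadlag : cadlag path_fun }.

HB.instance Definition _ (R : realType) := gen_eqMixin (skorohod R).
HB.instance Definition _ (R : realType) := gen_choiceMixin (skorohod R).

(** The topology of the J1 metric, whose balls are the sets [J1_close e x] up to
    strictness of the inequalities in the supremum. Paths that agree on [0,1] are topologically
    indistinguishable. *)
Definition J1_open (R : realType) (A : set (skorohod R)) : Prop :=
  forall x, A x -> exists2 e : R, (0 < e)%R &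
    forall y : skorohod R, J1_close e x y -> A y.

Lemma J1_openT (R : realType) : J1_open [set: skorohod R].
Proof. by move=> x _; exists 1%R. Qed.

Lemma J1_openI (R : realType) : setI_closed (@J1_open R).
Proof.
move=> A B oA oB x [/oA[e e0 eA] /oB[f f0 fB]].
exists (Num.min e f); first by rewrite lt_min e0.
move=> y [u tu uP]; split; [apply: eA|apply: fB]; exists u => // t /uP[].
  by rewrite !lt_min => /andP[-> _] /andP[-> _].
by rewrite !lt_min => /andP[_ ->] /andP[_ ->].
Qed.

Lemma J1_open_bigU (R : realType) (I : Type) (f : I -> set (skorohod R)) :
  (forall i, J1_open (f i)) -> J1_open (\bigcup_i f i).
Proof.
move=> of_ x [i _ /of_[e e0 eP]]; exists e => // y /eP fiy.
by exists i.
Qed.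

HB.instance Definition _ (R : realType) :=
  isOpenTopological.Build (skorohod R) (@J1_openT R) (@J1_openI R)
    (@J1_open_bigU R).

Section process.
Context {R : realType} {d : measure_display} {Omega : measurableType d}.
Variables (P : probability Omega R) (X : nat -> {RV P >-> R}).

Definition partial_sum (n : nat) (w : Omega) : R := (\sum_(i < n) X i w)%R.

(** [Num.truncn] is the floor on nonnegative reals. *)
Definition scaled_sum (n : nat) (w : Omega) (t : R) : R :=
  (n%:R^-1 * partial_sum (Num.truncn (n%:R * t)) w)%R.

Definition scaled_cgf (n : nat) (theta : R) : \bar R :=
  (n%:R^-1)%:E * lne ('M_P (partial_sum n) theta).

Lemma scaled_sum_cadlag n w : cadlag (scaled_sum n w).
Proof.
have [->|n0] := posnP n.
  have -> : scaled_sum 0 w = cst 0%R.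
    by apply/funext => t; rewrite /scaled_sum invr0 mul0r.
  split=> t _; first exact: cvg_cst.
  exact: is_cvg_cst.
have n0' : (0 < n%:R :> R)%R by rewrite ltr0n.
split=> t /andP[t0 t1].
  apply: cvg_near_cst; near=> s.
  rewrite /scaled_sum; congr (_ * partial_sum _ w)%R.
  have nt0 : (0 <= n%:R * t)%R by rewrite mulr_ge0 ?ler0n.
  apply: truncn_def; apply/andP; split.
    apply: le_trans (_ : (n%:R * t <= _)%R); first by rewrite truncn_le.
    by rewrite ler_pM2l//; near: s; exact: nbhs_right_ge.
  rewrite mulrC -ltr_pdivlMr//; near: s; apply: nbhs_right_lt.
  by rewrite ltr_pdivlMr// mulrC truncnS_gt.
have nt0 : (0 < n%:R * t)%R by rewrite mulr_gt0.
have [m /andP[mt tm]] : exists m : nat, (m%:R < n%:R * t <= m.+1%:R)%R.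
  have /andP[kt tk] := truncn_itv (ltW nt0).
  move: kt; rewrite le_eqVlt => /orP[/eqP kt|kt].
    move: nt0 tk; rewrite -kt => + _.
    case: (Num.truncn _) => [|k]; first by rewrite ltxx.
    by move=> _; exists k; rewrite ltr_nat ltnSn lexx.
  by exists (Num.truncn (n%:R * t)); rewrite kt ltW.
apply: (is_cvg_near_cst (n%:R^-1 * partial_sum m w)%R); near=> s.
rewrite /scaled_sum; congr (_ * partial_sum _ w)%R.
apply: truncn_def; apply/andP; split.
  rewrite mulrC -ler_pdivrMr//; near: s; apply: nbhs_left_ge.
  by rewrite ltr_pdivrMr// mulrC.
apply: lt_le_trans tm; rewrite ltr_pM2l//; near: s; exact: nbhs_left_lt.
Unshelve. all: by end_near.
Qed.

Definition scaled_path (n : nat) (w : Omega) : skorohod R :=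
  Skorohod (scaled_sum_cadlag n w).

End process.

Section large_deviations.
Context {R : realType}.

Definition good_rate_function {T : topologicalType} (F : T -> \bar R) : Prop :=
  [/\ forall x, 0 <= F x, lower_semicontinuous F &
      forall a : R, compact [set x | F x <= a%:E]].

Definition convex_ereal (F : R -> \bar R) : Prop :=
  forall x y t : R, (0 <= t <= 1)%R ->
    F (t * x + (1 - t) * y)%R <= t%:E * F x + (1 - t)%:E * F y.

(** For the paths [scaled_path X n] the events below are measurable, since
    the path is a continuous function of finitely many variables. *)
Definition satisfies_LDP {d : measure_display} {Omega : measurableType d}
    (P : probability Omega R) {T : topologicalType} (x : nat -> Omega -> T)
    (F : T -> \bar R) : Prop :=
  (forall G : set T, open G ->
    - ereal_inf (F @` G) <=
      limn_einf (fun n => (n%:R^-1)%:E * lne (P (x n @^-1` G)))) /\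
  (forall C : set T, closed C ->
    limn_esup (fun n => (n%:R^-1)%:E * lne (P (x n @^-1` C))) <=
      - ereal_inf (F @` C)).

End large_deviations.

Section decomposition.
Context {R : realType}.
Local Notation leb := (@lebesgue_measure R).
Local Notation fmeasure := {finite_measure set (measurableTypeR R) -> \bar R}.

Definition mutually_singular (mu nu : set (measurableTypeR R) -> \bar R) :=
  exists A, [/\ measurable A, mu A = 0 & nu (~` A) = 0].

(** [g] is the density of the absolutely continuous part of [phi]; the positive
    and negative parts of the singular part are [t |-> mup `[0, t]] and
    [t |-> mdn `[0, t]], so that a value [phi 0 != 0] is an atom at 0. *)
Record decomposition (phi g : R -> R) (mup mdn : fmeasure) : Prop := {
  density_integrable : leb.-integrable `[0%R, 1%R] (EFin \o g) ;
  up_concentrated : mup (~` [set` `[0%R, 1%R]]) = 0 ;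
  down_concentrated : mdn (~` [set` `[0%R, 1%R]]) = 0 ;
  up_singular : mutually_singular mup leb ;
  down_singular : mutually_singular mdn leb ;
  up_down_singular : mutually_singular mup mdn ;
  decompositionE : forall t : R, (0 <= t <= 1)%R ->
    (phi t)%:E = \int[leb]_(s in `[0%R, t]) (g s)%:E
                 + mup [set` `[0%R, t]] - mdn [set` `[0%R, t]] }.

(** A path in L[0,1] has exactly one decomposition (up to a null set for [g]),
    so the infimum is over a single value. *)
Definition path_cost (th_dn th_up : \bar R) (c : R -> R -> \bar R)
    (phi : R -> R) : \bar R :=
  ereal_inf [set v | exists g mup mdn, decomposition phi g mup mdn /\
    v = \int[leb]_(s in `[0%R, 1%R]) c s (g s)
        + th_dn * mdn [set` `[0%R, 1%R]]
        + th_up * mup [set` `[0%R, 1%R]]].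

End decomposition.

Section variational_problem.
Context {R : realType}.
Variable Lam : R -> \bar R.

Definition rate (y : R) : \bar R :=
  ereal_sup [set (theta * y)%:E - Lam theta | theta in [set: R]].

Definition theta_down : \bar R :=
  ereal_sup [set theta%:E | theta in
    [set theta : R | (0 < theta)%R /\ Lam (- theta)%R < +oo]].

Definition theta_up : \bar R :=
  ereal_sup [set theta%:E | theta in
    [set theta : R | (0 < theta)%R /\ Lam theta < +oo]].

Definition path_rate (gam : skorohod R) : \bar R :=
  if `[< finite_variation gam >] then
    path_cost theta_down theta_up (fun _ y => rate y) gam
  else +oo.

Definition J (psi : R -> R) : \bar R :=
  path_cost theta_down theta_up
    (fun s y =>
       rate y * (\1_[set u | (0 < psi u)%R] s)%:E
       + ereal_inf [set rate x | x in [set x : R | (x <= 0)%R]]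
         * (\1_[set u | psi u = 0%R] s)%:E)
    psi.

Definition feasible (z : R) (psi : R -> R) : Prop :=
  finite_variation_pos psi /\
  \int[@lebesgue_measure R]_(s in `[0%R, 1%R]) (psi s)%:E = z%:E.

(** [J psi < +oo] because paths with infinite objective are not admissible
    solutions of a minimisation problem over an extended-real objective. *)
Definition optimal (z : R) (psi : R -> R) : Prop :=
  [/\ feasible z psi, J psi < +oo &
      forall phi, feasible z phi -> J psi <= J phi].

Definition rbar : \bar R :=
  ereal_sup [set r%:E | r in [set r : R | rate r < +oo]].

Definition positive_times (psi : R -> R) : set R :=
  [set t : R | (0 <= t <= 1)%R /\ (0 < psi t)%R].

Definition T0 (psi : R -> R) : R := inf (positive_times psi).

Definition T1 (psi : R -> R) : R := sup (positive_times psi).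

Definition max_slope_times (psi : R -> R) : set R :=
  [set t : R | (0 < t <= 1)%R /\
    exists r : R, [/\ (0 < r)%R, rbar = r%:E & is_left_derivative psi t r]].

(** The set of times is empty also when [rbar] is infinite or not positive. *)
Definition T00 (psi : R -> R) : R :=
  if `[< max_slope_times psi = set0 >] then T0 psi
  else sup (max_slope_times psi).

Definition is_gradient (F : R -> \bar R) (y p : R) : Prop :=
  (\forall x \near y, F x \is a fin_num) /\ is_derive y 1%R (fine \o F) p.

Definition affine_gradient (psi : R -> R) (b lam : R) : Prop :=
  forall t : R, (T00 psi < t < T1 psi)%R ->
    exists2 v : R, is_derive t 1%R psi v & is_gradient rate v (b - lam * t)%R.

End variational_problem.

(* Main.v *)
Require Import Defs.
From HB Require Import structures.
From mathcomp Require Import all_boot all_order all_algebra.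
From mathcomp Require Import all_classical all_reals all_analysis.
From mathcomp Require Import measurable_realfun.
From mathcomp Require Import ring lra.
Import Order.TTheory GRing.Theory Num.Theory numFieldNormedType.Exports.

Set Implicit Arguments.
Unset Strict Implicit.
Unset Printing Implicit Defensive.

Local Open Scope classical_set_scope.
Local Open Scope ring_scope.

(** The theorem is the transversality condition at the free time [T = T1 psi]
    at which the optimal path stops being positive. Write [v] for the slope of
    [psi] and [p t = b - lam * t] for the gradient of the rate at [v t]. Since
    [rate (- delta) = 0], staying at zero is free and so is descending with slope
    [- delta]. Whatever [psi] does after a time [tau] close to [T] can therefore
    be replaced by a free descent, and optimality says that this never pays.

    The replacement changes the area, which has to be restored on a fixed interval
    [`]s0, s2]] before [tau]. There [psi] is strictly concave, because its slope
    has a strictly decreasing gradient, and it is mixed with a path [chi] having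
    the same end values ([optimality_inequality]). If the descent adds area, [chi]
    is the chord, which lies below [psi] and by Jensen's inequality costs no more:
    the repair is free ([chord_inequality]). If the descent removes area, [chi] is
    made of the two tangents at the ends, and the repair costs at most a constant
    times the area ([tent_inequality]). Mixing keeps the area affine in the weight
    and, the rate being convex, the cost below the corresponding mixture.

    Four applications give the result. A jump of [psi] at [T] could be removed, or
    partly replaced by a free descent, at a profit
    ([endpoint_left_continuous]). If [p T < 0] the slopes before [T] are below
    [- delta]; the free descent lies above [psi] and saves a positive cost, with a
    free repair ([end_gradient_ge0]). If [p T > 0] the slopes exceed [- delta]; the
    free descent lies below [psi], the area it loses is of smaller order than the
    cost it saves, and the repair is again cheaper than the gain
    ([end_gradient_le0]). Hence [p T = 0], that is [b = lam * T]. Finally the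
    supporting line at [v t] has a gradient tending to zero, which by positivity
    of the rate on the right of [- delta] forces [v t] to tend to [- delta]; the
    mean value theorem turns this into the left derivative at [T].

    The objective is an infimum over decompositions of the path. Competitors are
    obtained by surgery on a nearly optimal decomposition of [psi], and the lower
    bounds on the cost of [psi] come from supporting lines and hold for every
    decomposition ([jensen_cost]). *)

(** * Cumulative functions of finite measures *)

Section cumulative.
Context {R : realType}.
Variable mu : {finite_measure set (measurableTypeR R) -> \bar R}.

Lemma exists_inv_lt (x : R) : 0 < x -> exists n : nat, n.+1%:R^-1 < x.
Proof.
move=> x0; have [n _ /(_ n (leqnn n)) /= nx] := near_infty_natSinv_lt (PosNum x0).
by exists n.
Qed.

(** Continuity from above at the empty set; together with the two choices of
    shrinking intervals below it gives both one-sided limits of the function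
    that sends [t] to the mass of [`[0, t]]. *)
Lemma measure_vanishing (F : nat -> set (measurableTypeR R)) (e : R) : 0 < e ->
  (forall n, measurable (F n)) -> nonincreasing_seq F -> \bigcap_n F n = set0 ->
  exists n, fine (mu (F n)) < e.
Proof.
move=> e0 mF niF F0.
have : mu \o F @ \oo --> mu (\bigcap_n F n).
  apply: nonincreasing_cvg_mu => //.
  - by rewrite -ge0_fin_numE// fin_num_measure.
  - by rewrite F0.
rewrite F0 measure0 => /fine_cvgP[_ /cvgrPdist_lt/(_ e e0)[n _ /(_ n (leqnn n))]].
rewrite /= sub0r normrN => h; exists n.
by apply: le_lt_trans h; exact: ler_norm.
Qed.

Lemma measure_small_right (t e : R) : 0 < e ->
  exists2 d : R, 0 < d & fine (mu [set` `]t, t + d]]) < e.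
Proof.
move=> e0; pose F n : set (measurableTypeR R) := [set` `]t, t + n.+1%:R^-1]].
have [] := @measure_vanishing F e e0.
- by move=> n; exact: measurable_itv.
- move=> m n mn; apply/subsetPset; apply: subset_itvl.
  by rewrite bnd_simp lerD2l lef_pV2 ?posrE// ler_nat.
- apply/seteqP; split => // x /= xF.
  have tx : t < x by have := xF 0%N I; rewrite /F /= in_itv /= => /andP[].
  have [|n nx] := @exists_inv_lt (x - t); first by rewrite subr_gt0.
  have := xF n I; rewrite /F /= in_itv /= => /andP[_].
  by rewrite leNgt -ltrBrDl nx.
- by move=> n nF; exists n.+1%:R^-1 => //; rewrite invr_gt0.
Qed.

Lemma measure_small_left (t e : R) : 0 < e ->
  exists2 d : R, 0 < d & fine (mu [set` `[t - d, t[]) < e.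
Proof.
move=> e0; pose F n : set (measurableTypeR R) := [set` `[t - n.+1%:R^-1, t[].
have [] := @measure_vanishing F e e0.
- by move=> n; exact: measurable_itv.
- move=> m n mn; apply/subsetPset; apply: subset_itvr.
  by rewrite bnd_simp lerD2l lerN2 lef_pV2 ?posrE// ler_nat.
- apply/seteqP; split => // x /= xF.
  have tx : x < t by have := xF 0%N I; rewrite /F /= in_itv /= => /andP[].
  have [|n nx] := @exists_inv_lt (t - x); first by rewrite subr_gt0.
  have := xF n I; rewrite /F /= in_itv /= => /andP[+ _].
  by rewrite leNgt ltrBrDr -ltrBrDl nx.
- by move=> n nF; exists n.+1%:R^-1 => //; rewrite invr_gt0.
Qed.

Lemma fine_measureU (A B : set (measurableTypeR R)) :
  measurable A -> measurable B -> [disjoint A & B] ->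
  fine (mu (A `|` B)) = fine (mu A) + fine (mu B).
Proof.
move=> mA mB /disj_set2P AB.
by rewrite measureU// fineD// fin_num_measure.
Qed.

Lemma fine_le_measure (A B : set (measurableTypeR R)) :
  measurable A -> measurable B -> A `<=` B -> fine (mu A) <= fine (mu B).
Proof.
by move=> mA mB AB; apply: fine_le; rewrite ?fin_num_measure// le_measure ?inE.
Qed.

Lemma cumulative_cvg_right (t : R) : 0 <= t ->
  fine (mu [set` `[0, s]]) @[s --> t^'+] --> fine (mu [set` `[0, t]]).
Proof.
move=> t0; apply/cvgrPdist_lt => e e0.
have [d d0 dE] := measure_small_right t e0.
near=> s; have ts : t < s by near: s; exact: nbhs_right_gt.
have -> : [set` `[0, s]] = [set` `[0, t]] `|` [set` `]t, s]] :> set R.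
  by rewrite -itv_bndbnd_setU ?bnd_simp// ltW.
rewrite fine_measureU//; last first.
  apply/disj_setPS => x []/=; rewrite !in_itv/= => /andP[_ xt] /andP[tx _].
  by have := lt_le_trans tx xt; rewrite ltxx.
rewrite opprD addrA subrr sub0r normrN ger0_norm ?fine_ge0//.
apply: le_lt_trans dE; apply: fine_le_measure => //.
apply: subset_itvl; rewrite bnd_simp; near: s; apply: nbhs_right_le.
by rewrite ltrDl.
Unshelve. all: by end_near. Qed.

Lemma cumulative_cvg_left (t : R) : 0 < t ->
  fine (mu [set` `[0, s]]) @[s --> t^'-] --> fine (mu [set` `[0, t[]).
Proof.
move=> t0; apply/cvgrPdist_lt => e e0.
have [d d0 dE] := measure_small_left t e0.
near=> s; have ts : s < t by near: s; exact: nbhs_left_lt.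
have s0 : 0 <= s by near: s; exact: nbhs_left_ge.
have -> : [set` `[0, t[] = [set` `[0, s]] `|` [set` `]s, t[] :> set R.
  by rewrite -itv_bndbnd_setU ?bnd_simp// ltW.
rewrite fine_measureU//; last first.
  apply/disj_setPS => x []/=; rewrite !in_itv/= => /andP[_ xt] /andP[tx _].
  by have := lt_le_trans tx xt; rewrite ltxx.
rewrite addrAC subrr add0r ger0_norm ?fine_ge0//.
apply: le_lt_trans dE; apply: fine_le_measure => //.
apply: subset_itvr; rewrite bnd_simp; near: s; apply: nbhs_left_ge.
by rewrite ltrBlDr ltrDl.
Unshelve. all: by end_near. Qed.

Lemma cumulative_homo :
  {homo (fun s : R => fine (mu [set` `[0, s]])) : x y / x <= y}.
Proof.
move=> x y xy; apply: fine_le_measure => //.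
by apply: subset_itvl; rewrite bnd_simp.
Qed.

End cumulative.

(** * Net mass of a decomposition *)

Section net_mass.
Context {R : realType}.
Local Notation leb := (@lebesgue_measure R).
Local Notation fmeasure := {finite_measure set (measurableTypeR R) -> \bar R}.
Local Notation borel := (set (measurableTypeR R)).

(** A path is recovered as the net mass of [`[0, t]], so changing a path on an
    interval amounts to changing its net mass there. *)
Definition net (g : R -> R) (mup mdn : fmeasure) (A : borel) : R :=
  \int[leb]_(s in A) g s + fine (mup A) - fine (mdn A).

Lemma measurable_itvR (i : interval R) : measurable ([set` i] : borel).
Proof. exact: measurable_itv. Qed.

Variables (psi g : R -> R) (mup mdn : fmeasure).
Hypothesis D : decomposition psi g mup mdn.
Local Notation netD := (net g mup mdn).

Lemma density_integrableS (A : borel) : measurable A -> A `<=` `[0, 1] ->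
  leb.-integrable A (EFin \o g).
Proof.
move=> mA A01; apply: integrableS (density_integrable D) => //.
Qed.

Lemma netU (A B : borel) : measurable A -> measurable B ->
  A `<=` `[0, 1] -> B `<=` `[0, 1] -> [disjoint A & B] ->
  netD (A `|` B) = netD A + netD B.
Proof.
move=> mA mB A1 B1 AB; rewrite /net Rintegral_setU//; last first.
  by apply: density_integrableS; [exact: measurableU|rewrite subUset].
rewrite !fine_measureU//; ring.
Qed.

Lemma decomposition_net t : 0 <= t <= 1 -> psi t = netD [set` `[0, t]].
Proof.
move=> t01; apply: EFin_inj; rewrite (decompositionE D t01) /net EFinB EFinD.
rewrite !fineK ?fin_num_measure//; last first.
apply: integrable_fin_num => //.
apply: density_integrableS => //; apply: subset_itvl.
by rewrite bnd_simp; case/andP: t01.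
Qed.

Lemma net_oc s t : 0 <= s -> s <= t -> t <= 1 ->
  netD [set` `]s, t]] = psi t - psi s.
Proof.
move=> s0 st t1; rewrite !decomposition_net ?s0 ?t1 ?(le_trans st)//;
  last by rewrite (le_trans s0).
have -> : [set` `[0, t]] = [set` `[0, s]] `|` [set` `]s, t]] :> set R.
  by rewrite -itv_bndbnd_setU ?bnd_simp.
rewrite netU//; first by rewrite addrAC subrr add0r.
- by apply: subset_itvl; rewrite bnd_simp (le_trans st).
- by apply: subset_itv; rewrite bnd_simp.
- apply/disj_setPS => x []/=; rewrite !in_itv/= => /andP[_ xt] /andP[tx _].
  by have := lt_le_trans tx xt; rewrite ltxx.
Qed.

Let G t := \int[leb]_(s in `[0, t]) g s.

Let G_cvg_right t : 0 <= t < 1 -> G s @[s --> t^'+] --> G t.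
Proof.
move=> /andP[t0 t1].
have := parameterized_integral_continuous ler01 (density_integrable D).
move=> /(continuous_within_itvP _ ltr01)[ci c0 c1].
move: t0; rewrite le_eqVlt => /predU1P[<-|t0]; first exact: c0.
by apply: cvg_at_right_filter; apply: ci; rewrite in_itv/= t0.
Qed.

Let G_cvg_left t : 0 < t <= 1 -> G s @[s --> t^'-] --> G t.
Proof.
move=> /andP[t0 t1].
have := parameterized_integral_continuous ler01 (density_integrable D).
move=> /(continuous_within_itvP _ ltr01)[ci c0 c1].
move: t1; rewrite le_eqVlt => /predU1P[->|t1]; first exact: c1.
by apply: cvg_at_left_filter; apply: ci; rewrite in_itv/= t0.
Qed.

Lemma decomposition_cvg_right t : 0 <= t < 1 -> psi s @[s --> t^'+] --> psi t.
Proof.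
move=> /[dup] t01 /andP[t0 t1].
rewrite decomposition_net ?t0 ?ltW//.
have : netD [set` `[0, s]] @[s --> t^'+] --> netD [set` `[0, t]].
  apply: cvgB; last exact: cumulative_cvg_right.
  by apply: cvgD; [exact: G_cvg_right|exact: cumulative_cvg_right].
apply: cvg_trans; apply: near_eq_cvg; near=> s.
rewrite -decomposition_net//; apply/andP; split.
  by apply: (le_trans t0); near: s; exact: nbhs_right_ge.
by near: s; exact: nbhs_right_le.
Unshelve. all: by end_near. Qed.

Lemma decomposition_cvg_left t : 0 < t <= 1 ->
  psi s @[s --> t^'-] --> netD [set` `[0, t[].
Proof.
move=> /[dup] t01 /andP[t0 t1].
have : netD [set` `[0, s]] @[s --> t^'-] --> netD [set` `[0, t[].
  apply: cvgB; last exact: cumulative_cvg_left.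
  apply: cvgD; last exact: cumulative_cvg_left.
  rewrite Rintegral_itv_bndo_bndc; first exact: G_cvg_left.
  apply: density_integrableS => //; apply: subset_itvl.
  by rewrite bnd_simp.
apply: cvg_trans; apply: near_eq_cvg; near=> s.
rewrite -decomposition_net//; apply/andP; split.
  by near: s; exact: nbhs_left_ge.
by apply: le_trans t1; near: s; exact: nbhs_left_le.
Unshelve. all: by end_near. Qed.

Lemma net_set0 : netD set0 = 0.
Proof. by rewrite /net Rintegral_set0 !measure0 addr0 subrr. Qed.

(** On an interval closed at [tau] the increment starts from the left limit at
    [tau]: a jump at [tau] is part of the net mass. *)
Lemma net_cc (tau t y : R) : 0 < tau -> tau <= t -> t <= 1 ->
  psi s @[s --> tau^'-] --> y -> netD [set` `[tau, t]] = psi t - y.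
Proof.
move=> tau0 taut t1 psiy.
have tau01 : 0 < tau <= 1 by rewrite tau0 (le_trans taut).
have <- := cvg_unique (@norm_hausdorff _ R) (decomposition_cvg_left tau01) psiy.
have t0 := le_trans (ltW tau0) taut.
rewrite decomposition_net ?t0 ?t1//.
have -> : [set` `[0, t]] = [set` `[0, tau[] `|` [set` `[tau, t]] :> set R.
  by rewrite -itv_bndbnd_setU ?bnd_simp// ltW.
rewrite netU//; first by rewrite addrAC subrr add0r.
- by apply: subset_itvl; rewrite bnd_simp (le_trans taut).
- by apply: subset_itv; rewrite bnd_simp// ltW.
- apply/disj_setPS => x []/=; rewrite !in_itv/= => /andP[_ xt] /andP[tx _].
  by have := lt_le_trans xt tx; rewrite ltxx.
Qed.

(** Positive and negative parts of the density and of the singular part can be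
    grouped into two nondecreasing functions on [0,1], whose difference is the
    path. The second one is written as the first minus the path, so that the
    identity holds on the whole line, also outside [0,1]. *)
Lemma decomposition_finite_variation : finite_variation psi.
Proof.
split; first split.
- by move=> t; exact: decomposition_cvg_right.
- move=> t t01; apply/cvg_ex; exists (netD [set` `[0, t[]).
  exact: decomposition_cvg_left.
have ig := density_integrable D.
have sub01 t : t <= 1 -> [set` `[0, t]] `<=` [set` `[0, 1 : R]].
  by move=> t1; apply: subset_itvl; rewrite bnd_simp.
have homoG (h : R -> R) : leb.-integrable `[0, 1] (EFin \o h) ->
    (forall x, 0 <= h x) -> {in `[0, 1] &,
    {homo (fun t => \int[leb]_(s in `[0, t]) h s) : x y / x <= y}}.
  move=> ih h0 x y; rewrite !in_itv/= => /andP[x0 x1] /andP[y0 y1] xy.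
  rewrite -subr_ge0 Rintegral_itvB ?bnd_simp//.
    by apply: Rintegral_ge0.
  by apply: integrableS ih => //; exact: sub01.
have homoU := homoG _ (integrable_funrpos (measurable_itvR _) ig)
                (funrpos_ge0 g).
have homoD := homoG _ (integrable_funrneg (measurable_itvR _) ig)
                (funrneg_ge0 g).
pose U t := \int[leb]_(s in `[0, t]) g^\+ s + fine (mup [set` `[0, t]]).
have -> : psi = U \+ (\- (U \- psi)).
  by apply/funext => t; rewrite /= subKr ?addrC; ring.
apply: (bounded_variationD ltr01).
  apply: nondecreasing_bounded_variation => x y x1 y1 xy.
  by apply: lerD; [exact: homoU|exact: cumulative_homo].
apply/bounded_variationN/nondecreasing_bounded_variation => x y x1 y1 xy.
have E t : t \in `[0, 1] -> (U \- psi) t =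
    \int[leb]_(s in `[0, t]) g^\- s + fine (mdn [set` `[0, t]]).
  rewrite in_itv/= => /[dup] t01 /andP[t0 t1].
  rewrite /= decomposition_net// /net /U.
  have -> : \int[leb]_(s in `[0, t]) g s = \int[leb]_(s in `[0, t]) g^\+ s
      - \int[leb]_(s in `[0, t]) g^\- s.
    rewrite -RintegralB//.
    + by apply: eq_Rintegral => s _; rewrite -[in LHS](funrposBneg g).
    + apply: integrable_funrpos => //; apply: density_integrableS => //.
      exact: sub01.
    + apply: integrable_funrneg => //; apply: density_integrableS => //.
      exact: sub01.
  ring.
rewrite !E//.
by apply: lerD; [exact: homoD|exact: cumulative_homo].
Qed.

Lemma decomposition_measurable : measurable_fun ([set` `[0, 1]] : borel) psi.
Proof.
have : measurable_fun ([set` `[0, 1]] : borel) (fun t =>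
    G t + fine (mup [set` `[0, t]]) - fine (mdn [set` `[0, t]])).
  apply: measurable_funB; last first.
    exact: nondecreasing_measurable (cumulative_homo mdn).
  apply: measurable_funD; last first.
    exact: nondecreasing_measurable (cumulative_homo mup).
  apply: subspace_continuous_measurable_fun => //.
  exact: parameterized_integral_continuous ler01 (density_integrable D).
apply: eq_measurable_fun => t; rewrite inE/= in_itv/= => t01.
by rewrite decomposition_net.
Qed.

End net_mass.

(** * Surgery on decompositions *)

Section surgery.
Context {R : realType}.
Local Notation leb := (@lebesgue_measure R).
Local Notation borel := (set (measurableTypeR R)).
Local Notation fmeasure := {finite_measure set (measurableTypeR R) -> \bar R}.

(** A copy of [measure_add] that carries a finite measure structure. *)
Definition fadd (m1 m2 : fmeasure) : borel -> \bar R := measure_add m1 m2.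

HB.instance Definition _ (m1 m2 : fmeasure) := Measure.on (fadd m1 m2).

Let fadd_fin (m1 m2 : fmeasure) : fin_num_fun (fadd m1 m2).
Proof.
by move=> A mA; rewrite /fadd measure_addE fin_numD !fin_num_measure.
Qed.

HB.instance Definition _ (m1 m2 : fmeasure) :=
  @Measure_isFinite.Build _ _ _ (fadd m1 m2) (fadd_fin m1 m2).

(** Inside [B] this is [(1 - kap) * g + kap * k]; the form below makes its
    integral split without a case analysis. *)
Definition splice_density (g k : R -> R) (kap : R) (B : borel) : R -> R :=
  fun s => g s + kap * ((fun u => k u - g u) \_ B) s.

(** Mixing with a path that has no singular part on [B] scales the singular part
    there by [1 - kap]. *)
Definition splice_measure (mu : fmeasure) (kap : R) (kap1 : 0 <= 1 - kap)
    (B : borel) (mB : measurable B) : borel -> \bar R :=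
  fadd (mrestr mu (measurableC mB)) (mscale (NngNum kap1) (mrestr mu mB)).

HB.instance Definition _ mu kap kap1 B mB :=
  FiniteMeasure.on (@splice_measure mu kap kap1 B mB).

Definition add_atom (mu : fmeasure) (j : R) (j0 : 0 <= j) (sig : R) :
    borel -> \bar R :=
  fadd mu (mscale (NngNum j0) (\d_ (sig : measurableTypeR R))).

HB.instance Definition _ mu j j0 sig :=
  FiniteMeasure.on (@add_atom mu j j0 sig).

Lemma fine_splice_measure mu kap kap1 B mB (A : borel) : measurable A ->
  fine (@splice_measure mu kap kap1 B mB A) =
  fine (mu A) - kap * fine (mu (A `&` B)).
Proof.
move=> mA; rewrite /splice_measure /fadd measure_addE/= /mscale/= /mrestr.
have mAB : measurable (A `&` B) by exact: measurableI.
have mAC : measurable (A `&` ~` B).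
  by apply: measurableI => //; exact: measurableC.
rewrite fineD ?fineM ?fin_numM ?fin_num_measure//=.
have -> : fine (mu A) = fine (mu (A `&` ~` B)) + fine (mu (A `&` B)).
  rewrite -fine_measureU//; last by apply/disj_setPS => x [[_ +] [_]].
  by rewrite -setIUr setUC setUv setIT.
ring.
Qed.

Lemma fine_add_atom mu j j0 sig (A : borel) : measurable A ->
  fine (@add_atom mu j j0 sig A) = fine (mu A) + j * \1_A sig.
Proof.
move=> mA; rewrite /add_atom /fadd measure_addE/= /mscale/= diracE.
by rewrite fineD ?fin_num_measure// indicE.
Qed.

Lemma fine_measure_eq0 (mu : fmeasure) (A : borel) : measurable A ->
  fine (mu A) = 0 -> mu A = 0%E.
Proof. by move=> mA muA; rewrite -[LHS]fineK ?fin_num_measure// muA. Qed.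

Lemma mutually_singularC (mu nu : borel -> \bar R) :
  mutually_singular mu nu -> mutually_singular nu mu.
Proof.
move=> [A [mA muA nuA]]; exists (~` A); split => //; first exact: measurableC.
by rewrite setCK.
Qed.

Lemma mutually_singular_null (mu mu' nu nu' : borel -> \bar R) :
  (forall A, measurable A -> mu A = 0%E -> mu' A = 0%E) ->
  (forall A, measurable A -> nu A = 0%E -> nu' A = 0%E) ->
  mutually_singular mu nu -> mutually_singular mu' nu'.
Proof.
move=> hmu hnu [A [mA muA nuA]]; exists A; split => //; first exact: hmu.
by apply: hnu => //; exact: measurableC.
Qed.

Lemma splice_measure_null (mu : fmeasure) kap kap1 B mB (A : borel) : measurable A ->
  mu A = 0%E -> @splice_measure mu kap kap1 B mB A = 0%E.
Proof.
move=> mA muA; apply: fine_measure_eq0 => //; rewrite fine_splice_measure// muA.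
rewrite (_ : mu (A `&` B) = 0%E) ?mulr0 ?subr0//.
apply/eqP; rewrite -measure_le0 -muA le_measure ?inE//.
exact: measurableI.
Qed.

(** The new atom is moved to the other half of the separating set. *)
Lemma add_atom_singular (mu : {measure set (measurableTypeR R) -> \bar R})
  (nu : fmeasure)
  j j0 sig : mu [set sig] = 0%E ->
  mutually_singular mu nu -> mutually_singular mu (@add_atom nu j j0 sig).
Proof.
move=> mus [A [mA muA nuA]]; exists (A `|` [set sig]).
split; first exact: measurableU.
  apply/eqP; rewrite -measure_le0.
  rewrite (le_trans (measureU2 mu mA (measurable_set1 _)))//=.
  by rewrite [X in (X + _)%E]muA mus adde0.
have mC : measurable (~` (A `|` [set sig]) : borel).
  by apply: measurableC; exact: measurableU.
apply: fine_measure_eq0 => //; rewrite fine_add_atom// indicE.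
rewrite (_ : nu _ = 0%E); last first.
  apply/eqP; rewrite -measure_le0 -nuA le_measure ?inE//.
    exact: measurableC.
  by apply: subsetC; exact: subsetUl.
by rewrite memNset ?mulr0 ?addr0//= => h; apply: h; right.
Qed.

Variables (psi g : R -> R) (mup mdn : fmeasure).
Hypothesis D : decomposition psi g mup mdn.

(** Mixing, on [B], with an absolutely continuous path of density [k] keeps the
    three singularity conditions, since null sets of the old singular parts stay
    null. *)
Lemma splice_decomposition (k : R -> R) (kap : R) (kap1 : 0 <= 1 - kap) (B : borel)
    (mB : measurable B) (phi : R -> R) :
  B `<=` `[0, 1] ->
  leb.-integrable `[0, 1] (EFin \o k) ->
  (forall t, 0 <= t <= 1 -> phi t = psi t
     - kap * net g mup mdn ([set` `[0, t]] `&` B)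
     + kap * \int[leb]_(s in [set` `[0, t]] `&` B) k s) ->
  decomposition phi (splice_density g k kap B)
    (splice_measure mup kap1 mB) (splice_measure mdn kap1 mB).
Proof.
move=> B01 ik phiE.
have mC01 : measurable (~` `[0, 1]%classic : borel).
  by apply: measurableC; exact: measurable_itvR.
have igd : leb.-integrable `[0, 1] (EFin \o (fun u => k u - g u)).
  rewrite (_ : EFin \o _ = ((EFin \o k) \- (EFin \o g))%E)//.
  by apply: integrableB => //; exact: density_integrable D.
have igB : leb.-integrable `[0, 1] (EFin \o ((fun u => k u - g u) \_ B)).
  rewrite -restrict_EFin; apply/integrable_restrict => //.
  rewrite setIidr//.
  by apply: integrableS igd.
have isp : leb.-integrable `[0, 1] (EFin \o splice_density g k kap B).
  rewrite (_ : EFin \o _ = ((EFin \o g) \+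
    (fun s => kap%:E * (((fun u => k u - g u) \_ B) s)%:E))%E)//.
  apply: integrableD => //; first exact: density_integrable D.
  exact: integrableZl.
split => //.
- by apply: splice_measure_null => //; exact: up_concentrated D.
- by apply: splice_measure_null => //; exact: down_concentrated D.
- apply: mutually_singular_null (up_singular D) => // A mA.
  exact: splice_measure_null.
- apply: mutually_singular_null (down_singular D) => // A mA.
  exact: splice_measure_null.
- apply: mutually_singular_null (up_down_singular D) => A mA.
  + exact: splice_measure_null.
  + exact: splice_measure_null.
move=> t t01.
have tsub : [set` `[0, t]] `<=` [set` `[0, 1 : R]].
  by apply: subset_itvl; rewrite bnd_simp; case/andP: t01.
have mtB : measurable ([set` `[0, t]] `&` B : borel) by exact: measurableI.
have tBsub : [set` `[0, t]] `&` B `<=` `[0, 1] by move=> x [_ /B01].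
have igt : leb.-integrable `[0, t] (EFin \o splice_density g k kap B).
  by apply: integrableS isp.
rewrite -[X in (X + _ - _)%E]fineK; last exact: integrable_fin_num igt.
rewrite -(fineK (fin_num_measure (splice_measure mup _ _) _ _))//.
rewrite -(fineK (fin_num_measure (splice_measure mdn _ _) _ _))//.
rewrite -EFinD; congr EFin.
rewrite phiE// (decomposition_net D)// /net !fine_splice_measure//.
rewrite -/(\int[leb]_(s in `[0, t]) (splice_density g k kap B s))%R.
rewrite RintegralD//; last 2 first.
- exact: (density_integrableS D).
- apply: integrableS (integrableZl _ kap igB) => //.
rewrite RintegralZl//; last by apply: integrableS igB.
rewrite -Rintegral_mkcondr RintegralB//; last 2 first.
- by apply: integrableS ik.
- exact: (density_integrableS D).
ring.
Qed.

(** A downward jump may be inserted at any point where the path has no upward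
    jump; the hypothesis on [mup] keeps the two singular parts separated. *)
Lemma add_atom_decomposition (j : R) (j0 : 0 <= j) (sig : R) (phi : R -> R) :
  0 <= sig <= 1 -> mup [set sig] = 0%E ->
  (forall t, 0 <= t <= 1 -> phi t = psi t - j * (sig <= t)%R%:R) ->
  decomposition phi g mup (add_atom mdn j0 sig).
Proof.
move=> sig01 mups phiE.
split; try by case: D.
- have mC01 : measurable (~` `[0, 1]%classic : borel).
    by apply: measurableC; exact: measurable_itvR.
  apply: fine_measure_eq0 => //; rewrite fine_add_atom//.
  rewrite (down_concentrated D) indicE memNset ?mulr0 ?addr0//=.
- apply/mutually_singularC/add_atom_singular; first exact: lebesgue_measure_set1.
  exact/mutually_singularC/(down_singular D).
- by apply: add_atom_singular => //; exact: up_down_singular D.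
move=> t t01.
have tsub : [set` `[0, t]] `<=` [set` `[0, 1 : R]].
  by apply: subset_itvl; rewrite bnd_simp; case/andP: t01.
have igt := density_integrableS D (measurable_itvR _) tsub.
rewrite -[X in (X + _ - _)%E]fineK; last exact: integrable_fin_num igt.
rewrite -(fineK (fin_num_measure mup _ _))//.
rewrite -(fineK (fin_num_measure (add_atom mdn _ _) _ _))//.
rewrite -EFinD; congr EFin.
rewrite phiE// (decomposition_net D)// /net fine_add_atom// indicE.
have -> : (sig \in [set` `[0, t]]) = (sig <= t).
  by rewrite mem_setE in_itv/=; case/andP: sig01 => ->.
rewrite /Rintegral; ring.
Qed.

End surgery.

(** * The cost of a decomposition *)

Section cost.
Context {R : realType}.
Local Notation leb := (@lebesgue_measure R).
Local Notation borel := (set (measurableTypeR R)).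
Local Notation fmeasure := {finite_measure set (measurableTypeR R) -> \bar R}.
Local Open Scope ereal_scope.

Variables (I : R -> \bar R) (thd thu : \bar R).
Hypotheses (I_ge0 : forall y, 0 <= I y) (mI : measurable_fun [set: R] I).
Hypotheses (I_convex : convex_ereal I) (thd_ge0 : 0 <= thd) (thu_ge0 : 0 <= thu).

Definition running_cost (psi g : R -> R) (s : R) : \bar R :=
  I (g s) * (\1_[set u | (0 < psi u)%R] s)%:E.

(** The objective restricted to a set and to one decomposition. Staying at zero is
    free for the rate functions considered here, hence only the running cost
    where the path is positive appears. *)
Definition cost (psi g : R -> R) (mup mdn : fmeasure) (A : borel) : \bar R :=
  \int[leb]_(s in A) running_cost psi g s + thd * mdn A + thu * mup A.

Lemma running_cost_ge0 psi g s : 0 <= running_cost psi g s.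
Proof. by rewrite /running_cost mule_ge0// lee_fin indicE ler0n. Qed.

Lemma measurable_running_cost (psi g : R -> R) :
  measurable_fun ([set` `[0%R, 1%R]] : borel) psi ->
  measurable_fun ([set` `[0%R, 1%R]] : borel) g ->
  measurable_fun ([set` `[0%R, 1%R]] : borel) (running_cost psi g).
Proof.
move=> mpsi mg.
apply: (@eq_measurable_fun _ _ _ _ _
    (fun s => if (0 < psi s)%R then I (g s) else 0)) => [s _|].
  rewrite /running_cost indicE; case: ifPn => s0.
    by rewrite mem_set// mule1.
  by rewrite memNset ?mule0//; apply/negP.
have mIg : measurable_fun ([set` `[0%R, 1%R]] : borel) (I \o g).
  exact: (measurableT_comp mI).
apply: measurable_fun_if => //.
  by apply: measurable_fun_ltr => //; exact: measurable_cst.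
by apply: measurable_funS mIg => //; exact: measurable_itvR.
Qed.

Lemma cost_ge0 psi g mup mdn A : 0 <= cost psi g mup mdn A.
Proof.
apply: adde_ge0; last exact: mule_ge0.
apply: adde_ge0; last exact: mule_ge0.
by apply: integral_ge0 => s _; exact: running_cost_ge0.
Qed.

Section one_decomposition.
Variables (psi g : R -> R) (mup mdn : fmeasure).
Hypothesis D : decomposition psi g mup mdn.
Local Notation costD := (cost psi g mup mdn).

Lemma decomposition_running_cost (A : borel) : measurable A ->
  A `<=` [set` `[0%R, 1%R]] -> measurable_fun A (running_cost psi g).
Proof.
move=> mA A01; apply: measurable_funS (measurable_running_cost _ _) => //.
  exact: (decomposition_measurable D).
by apply/measurable_EFinP; exact: measurable_int (density_integrable D).
Qed.

Lemma costU (A B : borel) : measurable A -> measurable B ->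
  A `<=` [set` `[0%R, 1%R]] -> B `<=` [set` `[0%R, 1%R]] -> [disjoint A & B] ->
  costD (A `|` B) = costD A + costD B.
Proof.
move=> mA mB A1 B1 AB; rewrite /cost ge0_integral_setU//; last 2 first.
- apply: decomposition_running_cost; first exact: measurableU.
  by rewrite subUset.
- by move=> s _; exact: running_cost_ge0.
have AB0 := disj_set2P AB.
rewrite !measureU// !ge0_muleDr//.
by rewrite [RHS]addeACA [X in _ = X + _]addeACA.
Qed.

Lemma cost_le (A B : borel) : measurable A -> measurable B ->
  B `<=` [set` `[0%R, 1%R]] -> A `<=` B -> costD A <= costD B.
Proof.
move=> mA mB B1 AB.
have mBA : measurable (B `\` A) by exact: measurableD.
rewrite -(setDUK AB) costU//.
- by rewrite leeDl// cost_ge0.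
- exact: subset_trans AB _.
- by move=> x [/B1].
- by apply/disj_setPS => x [Ax [_ /(_ Ax)]].
Qed.

(** Jensen's inequality, with the singular part included: integrate the
    supporting line of slope [p] at the mean slope [w]. The singular parts are
    charged at least [p] and [- p] per unit because [p] lies between [- thd] and
    [thu], so only the total increment of the path matters. *)
Lemma jensen_cost (s t r p w : R) :
  (0 <= s)%R -> (s < t)%R -> (t <= 1)%R ->
  (forall u, (s < u < t)%R -> (0 < psi u)%R) ->
  (psi t - psi s = w * (t - s))%R ->
  (forall y, (r + p * (y - w))%:E <= I y) ->
  (- p)%:E <= thd -> p%:E <= thu ->
  ((t - s) * r)%:E <= costD [set` `]s, t]].
Proof.
move=> s0 st t1 psi0 slope supp pd pu.
set A : borel := [set` `]s, t]].
have mA : measurable A by exact: measurable_itvR.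
have A01 : A `<=` [set` `[0%R, 1%R]].
  by apply: subset_itv; rewrite bnd_simp.
pose h x : R := (r + p * (g x - w))%R.
have ig : leb.-integrable A (EFin \o g) by exact: (density_integrableS D).
have lA : leb A = (t - s)%:E.
  by rewrite lebesgue_measure_itv/= lte_fin st -EFinB.
have finA : leb A < +oo by rewrite lA ltry.
have icst (c : R) : leb.-integrable A (EFin \o cst c).
  by apply: measurable_bounded_integrable => //; exact: bounded_cst.
have ipg : leb.-integrable A (EFin \o (fun x => p * g x)%R).
  by rewrite (_ : EFin \o _ = fun x => p%:E * (EFin \o g) x)//; exact: integrableZl.
have hE : h = ((cst (r - p * w)%R) \+ (fun x => p * g x)%R)%R.
  by apply/funext => x; rewrite /h /=; ring.
have ih : leb.-integrable A (EFin \o h).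
  rewrite hE (_ : EFin \o _ = (EFin \o cst (r - p * w)%R) \+
     (EFin \o (fun x => p * g x)%R))//.
  exact: integrableD.
have int_h : (\int[leb]_(x in A) h x = (r - p * w) * (t - s) +
    p * \int[leb]_(x in A) g x)%R.
  rewrite hE RintegralD// RintegralZl//; congr (_ + _)%R.
  by rewrite [LHS](Rintegral_cst leb mA (r - p * w)) [X in fine X]lA.
have run : (\int[leb]_(x in A) h x)%R%:E <= \int[leb]_(x in A) running_cost psi g x.
  (* the supporting line may be negative, the rate is not: compare with the
     positive part *)
  apply: (@le_trans _ _ (\int[leb]_(x in A) (h^\+ x)%R%:E)).
    rewrite -[leRHS]fineK; last first.
      apply: integrable_fin_num => //; exact: integrable_funrpos.
    rewrite lee_fin; apply: le_Rintegral => //.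
      exact: integrable_funrpos.
    by move=> x _; rewrite /funrpos le_max lexx.
  have mrun := decomposition_running_cost mA A01.
  have mh : measurable_fun A (fun x => (h^\+ x)%R%:E).
    by apply: (measurable_int leb); exact: integrable_funrpos.
  have soo : `]s, t[%classic `<=` (A : set R).
    by apply: subset_itvl; rewrite bnd_simp.
  rewrite /A integral_itv_bndoo; last by apply: measurable_funS mh.
  rewrite [leRHS]integral_itv_bndoo; last by apply: measurable_funS mrun.
  apply: ge0_le_integral => //.
  - by move=> x _; rewrite lee_fin funrpos_ge0.
  - by apply: measurable_funS mh.
  - by apply: measurable_funS mrun.
  move=> x /= xst.
  rewrite /running_cost indicE mem_set ?mule1; last first.
    by rewrite /=; apply: psi0; move: xst; rewrite in_itv.
  by rewrite /funrpos EFin_max ge_max supp I_ge0.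
have fup := fineK (fin_num_measure mup A mA).
have fdn := fineK (fin_num_measure mdn A mA).
apply: (@le_trans _ _ ((\int[leb]_(x in A) h x)%R%:E + (- p)%:E * mdn A
    + p%:E * mup A)).
  have := net_oc D s0 (ltW st) t1; rewrite slope /net -/A => e.
  rewrite -fup -fdn -!EFinM -!EFinD lee_fin int_h.
  rewrite le_eqVlt; apply/orP; left; apply/eqP; move: e.
  set x := Rintegral _ _ _; set y := fine _; set z := fine _.
  move=> e; have -> : x = (w * (t - s) + z - y)%R by rewrite -e; ring.
  by ring.
by apply: leeD; [apply: leeD|]; rewrite ?run// lee_wpmul2r.
Qed.

End one_decomposition.

Lemma eq_cost psi psi' g g' (mup mup' mdn mdn' : fmeasure) (A : borel) :
  (forall s, A s -> psi s = psi' s) -> (forall s, A s -> g s = g' s) ->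
  mup A = mup' A -> mdn A = mdn' A ->
  cost psi g mup mdn A = cost psi' g' mup' mdn' A.
Proof.
move=> psiE gE upE dnE; rewrite /cost upE dnE; congr (_ + _ + _).
apply: eq_integral => s /set_mem As.
rewrite /running_cost !indicE gE//; congr (_ * (_%:R)%:E); congr nat_of_bool.
by apply/idP/idP => /set_mem/= h; apply/mem_set; rewrite /= ?psiE// -psiE.
Qed.

Lemma fine_measure_inj (mu nu : fmeasure) (A : borel) : measurable A ->
  fine (mu A) = fine (nu A) -> mu A = nu A.
Proof.
by move=> mA e; rewrite -[LHS]fineK ?fin_num_measure// e fineK ?fin_num_measure.
Qed.

Lemma splice_measure_off (mu : fmeasure) kap kap1 (B : borel)
    (mB : measurable B) (A : borel) : measurable A -> A `&` B = set0 ->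
  @splice_measure _ mu kap kap1 B mB A = mu A.
Proof.
move=> mA AB; apply: fine_measure_inj => //.
by rewrite fine_splice_measure// AB measure0 mulr0 subr0.
Qed.

Lemma splice_measure_on (mu : fmeasure) kap kap1 (B : borel)
    (mB : measurable B) :
  @splice_measure _ mu kap kap1 B mB B = (1 - kap)%:E * mu B.
Proof.
rewrite -[mu B]fineK ?fin_num_measure// -EFinM.
rewrite -[LHS]fineK ?fin_num_measure// fine_splice_measure// setIid; congr EFin.
by ring.
Qed.

Lemma splice_densityE (g k : R -> R) kap (B : borel) s :
  splice_density g k kap B s =
  (if s \in B then (1 - kap) * g s + kap * k s else g s)%R.
Proof.
by rewrite /splice_density patchE; case: ifP => _; [ring|rewrite mulr0 addr0].
Qed.

Lemma splice_cost_off psi phi g k kap kap1 (mup mdn : fmeasure) (B : borel)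
    (mB : measurable B) (A : borel) : measurable A -> A `&` B = set0 ->
  (forall s, A s -> phi s = psi s) ->
  cost phi (splice_density g k kap B) (@splice_measure _ mup kap kap1 B mB)
    (@splice_measure _ mdn kap kap1 B mB) A = cost psi g mup mdn A.
Proof.
move=> mA AB phiE; apply: eq_cost => //; last 2 first.
- exact: splice_measure_off.
- exact: splice_measure_off.
move=> s As; rewrite splice_densityE memNset// => Bs.
by have : (A `&` B) s by []; rewrite AB.
Qed.

(** Convexity of the running cost, for any weight [kap]. Positivity of the old
    path on [B] is what prevents the old cost from having been waived there. *)
Lemma splice_cost_on (psi phi g k : R -> R) (kap : R) (kap0 : (0 <= kap)%R)
    (kap1 : (0 <= 1 - kap)%R) (mup mdn : fmeasure) (B : borel)
    (mB : measurable B) : B `<=` [set` `[0%R, 1%R]] ->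
  decomposition psi g mup mdn ->
  measurable_fun ([set` `[0%R, 1%R]] : borel) phi ->
  measurable_fun ([set` `[0%R, 1%R]] : borel) k ->
  (forall s, B s -> (0 < psi s)%R) ->
  cost phi (splice_density g k kap B) (@splice_measure _ mup kap kap1 B mB)
    (@splice_measure _ mdn kap kap1 B mB) B <=
  (1 - kap)%:E * cost psi g mup mdn B + kap%:E * \int[leb]_(s in B) I (k s).
Proof.
move=> B01 D mphi mk psi0.
have mg : measurable_fun ([set` `[0%R, 1%R]] : borel) g.
  by apply/measurable_EFinP; exact: measurable_int (density_integrable D).
have mpsi := decomposition_running_cost D mB B01.
have mIk : measurable_fun B (fun s => I (k s)).
  apply: (measurableT_comp mI); apply: measurable_funS mk => //.
have msg : measurable_fun ([set` `[0%R, 1%R]] : borel)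
    (splice_density g k kap B).
  apply: (@eq_measurable_fun _ _ _ _ _ (fun s => g s + kap *
      ((k s - g s) * \1_B s))%R) => [s _|].
    rewrite splice_densityE indicE; case: (s \in B).
      by rewrite mulr1; ring.
    by rewrite !mulr0 addr0.
  apply: measurable_funD => //; apply: measurable_funM => //.
  apply: measurable_funM; first exact: measurable_funB.
  exact: measurable_indic.
have kE : (kap%:E * \int[leb]_(s in B) I (k s) =
    \int[leb]_(s in B) (kap%:E * I (k s)))%E.
  by rewrite ge0_integralZl_EFin.
rewrite /cost [X in thd * X]splice_measure_on [X in thu * X]splice_measure_on kE.
have run0 : 0 <= \int[leb]_(s in B) running_cost psi g s.
  by apply: integral_ge0 => s _; exact: running_cost_ge0.
have dn0 : 0 <= thd * mdn B by exact: mule_ge0.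
have up0 : 0 <= thu * mup B by exact: mule_ge0.
rewrite (ge0_muleDr _ (adde_ge0 run0 dn0) up0) (ge0_muleDr _ run0 dn0).
rewrite -ge0_integralZl_EFin//; last first.
  by move=> s _; exact: running_cost_ge0.
rewrite [leRHS]addeAC; apply: leeD; last by rewrite muleCA.
rewrite [leRHS]addeAC; apply: leeD; last by rewrite muleCA.
have m1 : measurable_fun B (fun s => (1 - kap)%:E * running_cost psi g s).
  exact: measurable_funeM.
have m2 : measurable_fun B (fun s => kap%:E * I (k s)).
  exact: measurable_funeM.
rewrite -ge0_integralD//; last 2 first.
- by move=> s _; rewrite mule_ge0// running_cost_ge0.
- by move=> s _; rewrite mule_ge0.
apply: ge0_le_integral => //.
- by move=> s _; exact: running_cost_ge0.
- by apply: measurable_funS (measurable_running_cost mphi msg).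
- exact: emeasurable_funD.
move=> s Bs; rewrite [leLHS]/running_cost splice_densityE mem_set//.
apply: (@le_trans _ _ (I ((1 - kap) * g s + kap * k s)%R)).
  rewrite -[leRHS]mule1; apply: lee_wpmul2l => //.
  by rewrite lee_fin indicE; case: (_ \in _).
have := @I_convex (g s) (k s) (1 - kap)%R; rewrite subKr.
rewrite kap1 lerBlDr lerDl kap0 => /(_ isT) /le_trans; apply.
by rewrite /running_cost indicE mem_set ?mule1//; exact: psi0.
Qed.

End cost.

(** * Competing paths *)

Section competitor.
Context {R : realType}.
Local Notation leb := (@lebesgue_measure R).
Local Notation borel := (set (measurableTypeR R)).
Local Notation fmeasure := {finite_measure set (measurableTypeR R) -> \bar R}.

(** The area is affine in the weight [kap], so a suitable weight restores the area
    constraint exactly. *)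
Definition bend (psi chi : R -> R) (s0 s2 kap : R) (t : R) : R :=
  psi t + (if s0 < t <= s2 then kap * (chi t - psi t) else 0).

(** The free continuation of a path after [tau]: neither the slope [- delta] nor
    staying at zero is charged, only a jump at [sig] is, if there is one. *)
Definition descend (psi : R -> R) (tau sig y delta : R) (t : R) : R :=
  if t < tau then psi t else if t < sig then y - delta * (t - tau) else 0.

Variables (psi g : R -> R) (mup mdn : fmeasure).
Hypothesis D : decomposition psi g mup mdn.

Lemma bend_decomposition (chi k : R -> R) (s0 s2 kap : R) (kap1 : 0 <= 1 - kap) :
  0 <= s0 -> s0 <= s2 -> s2 <= 1 ->
  leb.-integrable `[0, 1] (EFin \o k) ->
  (forall u, s0 <= u <= s2 -> \int[leb]_(s in `]s0, u]) k s = chi u - psi s0) ->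
  chi s2 = psi s2 ->
  decomposition (bend psi chi s0 s2 kap)
    (splice_density g k kap [set` `]s0, s2]])
    (splice_measure mup kap1 (measurable_itvR `]s0, s2]))
    (splice_measure mdn kap1 (measurable_itvR `]s0, s2])).
Proof.
move=> s00 s02 s21 ik chiE chi2.
apply: (splice_decomposition D) => //.
  by apply: subset_itv; rewrite bnd_simp.
move=> t /andP[t0 t1].
have -> : [set` `[0, t]] `&` [set` `]s0, s2]] =
    [set` `]s0, Num.min t s2]] :> set R.
  apply/seteqP; split => x /=; rewrite !in_itv/= le_min.
    by move=> [/andP[_ ->] /andP[-> ->]].
  by move=> /and3P[s0x -> ->]; rewrite s0x (le_trans s00 (ltW s0x)).
rewrite /bend; have [ts0|s0t] /= := leP t s0.
  rewrite (min_idPl (le_trans ts0 s02)) set_itv_ge ?bnd_simp -?leNgt//.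
  by rewrite (net_set0 g) Rintegral_set0 !mulr0 subr0.
have [ts2|s2t] := leP t s2.
  by rewrite (net_oc D)// ?(ltW s0t)// chiE ?(ltW s0t)//; ring.
by rewrite (net_oc D)// chiE ?lexx ?s02// chi2; ring.
Qed.

Lemma bend_outside (chi : R -> R) (s0 s2 kap t : R) :
  ~~ (s0 < t <= s2) -> bend psi chi s0 s2 kap t = psi t.
Proof. by rewrite /bend => /negbTE ->; rewrite addr0. Qed.

Definition drop_rate (delta sig : R) : R -> R := cst (- delta) \_ `]-oo, sig[.

Lemma int_drop_rate (delta sig tau t : R) : tau <= sig -> tau <= t ->
  \int[leb]_(s in `[tau, t]) drop_rate delta sig s =
  - delta * (Num.min t sig - tau).
Proof.
move=> tsig tt; rewrite -Rintegral_mkcondr Rintegral_cst; last first.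
  by apply: measurableI; exact: measurable_itvR.
congr (_ * _).
have [tsg|sgt] := ltP t sig.
  rewrite setIidl; last first.
    by move=> x /=; rewrite !in_itv/= => /andP[_ xt]; exact: le_lt_trans tsg.
  rewrite [X in fine X]lebesgue_measure_itv/= lte_fin.
  move: tt; rewrite le_eqVlt => /predU1P[->|->//].
  by rewrite ltxx subrr.
rewrite (_ : _ `&` _ = [set` `[tau, sig[]); last first.
  apply/seteqP; split => x /=; rewrite !in_itv/=.
    by move=> [/andP[-> _] ->].
  by move=> /andP[-> xs]; rewrite (le_trans (ltW xs) sgt).
rewrite [X in fine X]lebesgue_measure_itv/= lte_fin.
move: tsig; rewrite le_eqVlt => /predU1P[->|->//].
by rewrite ltxx subrr.
Qed.

Lemma integrable_drop_rate (delta sig : R) :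
  leb.-integrable `[0, 1] (EFin \o drop_rate delta sig).
Proof.
have finA : (leb `[0%R, 1%R] < +oo)%E.
  by rewrite lebesgue_measure_itv/= lte_fin ltr01 -EFinB ltry.
have i1 : leb.-integrable `[0, 1] (EFin \o cst (- delta)).
  by apply: measurable_bounded_integrable => //; exact: bounded_cst.
rewrite /drop_rate -restrict_EFin; apply/integrable_restrict => //.
apply: integrableS i1 => //.
by apply: measurableI; exact: measurable_itvR.
Qed.

Let one0 : 0 <= 1 - 1 :> R. Proof. by rewrite subrr. Qed.

(** The density is spliced first, which leaves the path constant after [sig], and
    the remaining height is then removed by an atom. When that height vanishes
    [sig] may exceed 1, and the (null) atom is put at 1. *)
Lemma descend_decomposition (tau sig y delta : R)
    (j0 : 0 <= y - delta * (sig - tau)) :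
  0 < tau -> tau <= 1 -> tau <= sig ->
  psi s @[s --> tau^'-] --> y ->
  (sig <= 1 \/ y - delta * (sig - tau) = 0) ->
  decomposition (descend psi tau sig y delta)
    (splice_density g (drop_rate delta sig) 1 [set` `[tau, 1]])
    (splice_measure mup one0 (measurable_itvR `[tau, 1]))
    (add_atom (splice_measure mdn one0 (measurable_itvR `[tau, 1])) j0
      (Num.min sig 1)).
Proof.
move=> tau0 tau1 tsig psiy sigj.
(* the path after splicing the density, before the final jump *)
pose psi2 t := if t < tau then psi t else y - delta * (Num.min t sig - tau).
have D2 : decomposition psi2
    (splice_density g (drop_rate delta sig) 1 [set` `[tau, 1]])
    (splice_measure mup one0 (measurable_itvR `[tau, 1]))
    (splice_measure mdn one0 (measurable_itvR `[tau, 1])).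
  apply: (splice_decomposition D) => //.
  - by apply: subset_itv; rewrite bnd_simp// ltW.
  - exact: integrable_drop_rate.
  move=> t /andP[t0 t1]; rewrite /psi2.
  have -> : [set` `[0, t]] `&` [set` `[tau, 1]] = [set` `[tau, t]] :> set R.
    apply/seteqP; split => x /=; rewrite !in_itv/=.
      by move=> [/andP[_ ->] /andP[->]].
    by move=> /andP[tx xt]; rewrite tx xt (le_trans xt t1) (le_trans (ltW tau0) tx).
  have [ttau|taut] := ltP t tau.
    rewrite set_itv_ge ?bnd_simp -?ltNge//.
    by rewrite (net_set0 g) Rintegral_set0 !mulr0 subr0 addr0.
  by rewrite (net_cc D tau0 taut t1 psiy) int_drop_rate//; ring.
apply: (add_atom_decomposition D2).
- by rewrite ge_min lexx orbT andbT le_min ler01 (le_trans (ltW tau0)).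
- apply: fine_measure_eq0 => //; rewrite fine_splice_measure// mul1r setIidl ?subrr//.
  move=> x /= ->; rewrite in_itv/= le_min tsig tau1 ge_min lexx orbT//.
- move=> t /andP[t0 t1]; rewrite /descend /psi2; have [ttau|taut] := ltP t tau.
    rewrite (_ : (_ <= _) = false) ?mulr0 ?subr0//; apply/negbTE.
    by rewrite -ltNge lt_min !(lt_le_trans ttau).
  have [tsg|sgt] := ltP t sig; last first.
    by rewrite (le_trans _ sgt) ?ge_min ?lexx// mulr1 subrr.
  case: sigj => [sig1|->]; last by rewrite mul0r subr0.
  by rewrite (min_idPl sig1) leNgt tsg mulr0 subr0.
Qed.

Local Open Scope ereal_scope.
Variables (I : R -> \bar R) (thd thu : \bar R).
Hypotheses (I_ge0 : forall y, 0 <= I y) (mI : measurable_fun [set: R] I).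
Hypotheses (I_convex : convex_ereal I) (thd_ge0 : 0 <= thd) (thu_ge0 : 0 <= thu).

Lemma add_atomE (mu : fmeasure) (j : R) (j0 : (0 <= j)%R) (sig : R) (A : borel) :
  measurable A -> add_atom mu j0 sig A = mu A + (j * \1_A sig)%:E.
Proof.
move=> mA; rewrite -[LHS]fineK ?fin_num_measure// fine_add_atom//.
by rewrite EFinD fineK ?fin_num_measure.
Qed.

(** Descending at slope [- delta] and staying at zero are both free, so the whole
    cost of the old path on [`[tau, 1]] is saved, except for the price of the
    final jump. *)
Lemma descend_cost (tau sig y delta : R)
    (j0 : (0 <= y - delta * (sig - tau))%R) :
  (0 < tau)%R -> (tau <= 1)%R -> (tau <= sig)%R ->
  psi s @[s --> tau^'-] --> y ->
  (sig <= 1 \/ y - delta * (sig - tau) = 0)%R ->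
  I (- delta) = 0 ->
  exists g' mup' mdn', decomposition (descend psi tau sig y delta) g' mup' mdn' /\
  cost I thd thu (descend psi tau sig y delta) g' mup' mdn' [set` `[0%R, 1%R]]
    + cost I thd thu psi g mup mdn [set` `[tau, 1%R]] <=
  cost I thd thu psi g mup mdn [set` `[0%R, 1%R]]
    + thd * (y - delta * (sig - tau))%:E.
Proof.
move=> tau0 tau1 tsig psiy sigj Id.
have D' := descend_decomposition j0 tau0 tau1 tsig psiy sigj.
eexists _, _, _; split; first exact: D'.
have E01 : [set` `[0%R, 1%R]] = [set` `[0%R, tau[] `|` [set` `[tau, 1%R]] :> set R.
  by rewrite -itv_bndbnd_setU ?bnd_simp// ltW.
have m0 : measurable ([set` `[0%R, tau[] : borel) by exact: measurable_itvR.
have m1 : measurable ([set` `[tau, 1%R]] : borel) by exact: measurable_itvR.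
have s0 : [set` `[0%R, tau[] `<=` [set` `[0%R, 1%R : R]].
  by apply: subset_itvl; rewrite bnd_simp.
have s1 : [set` `[tau, 1%R]] `<=` [set` `[0%R, 1%R : R]].
  by apply: subset_itvr; rewrite bnd_simp// ltW.
have dis : [disjoint ([set` `[0%R, tau[] : set R) & [set` `[tau, 1%R]]].
  apply/disj_setPS => x []/=; rewrite !in_itv/= => /andP[_ xt] /andP[tx _].
  by have := lt_le_trans xt tx; rewrite ltxx.
have dis0 := disj_set2P dis.
have sig1 : `[tau, 1%R]%classic (Num.min sig 1%R).
  by rewrite /= in_itv/= le_min tsig tau1 ge_min lexx orbT.
rewrite [in X in X + _ <= _]E01 [in leRHS]E01.
rewrite (costU thd thu I_ge0 mI D')// (costU thd thu I_ge0 mI D)//.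
rewrite [leLHS]addeAC [X in X + _ <= _](_ : _ =
  cost I thd thu psi g mup mdn [set` `[0%R, tau[] +
  cost I thd thu psi g mup mdn [set` `[tau, 1%R]]); last first.
  congr (_ + _); apply: eq_cost.
  - by move=> s /=; rewrite in_itv/= /descend => /andP[_ ->].
  - move=> s As; rewrite splice_densityE memNset// => Bs.
    by have : set0 s by rewrite -dis0.
  - exact: splice_measure_off.
  - rewrite [LHS]add_atomE// indicE memNset ?mulr0 ?adde0; last first.
      by move=> Bs; have : set0 (Num.min sig 1%R) by rewrite -dis0.
    exact: splice_measure_off.
apply: leeD => //; rewrite /cost integral0_eq; last first.
  move=> s As; rewrite /running_cost splice_densityE mem_set//.
  rewrite subrr mul0r add0r mul1r /drop_rate patchE.
  case: ifPn => [_|/negP ssig]; first by rewrite Id mul0e.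
  rewrite indicE memNset ?mule0//= /descend.
  move: As; rewrite /= in_itv/= => /andP[ts _].
  rewrite (ltNge s tau) ts/= ifF ?ltxx//; apply/negbTE/negP => ssg; apply: ssig.
  by rewrite mem_setE in_itv.
rewrite [X in thu * X]splice_measure_on subrr mul0e mule0 adde0 add0e.
rewrite [X in thd * X]add_atomE// indicE mem_set// mulr1.
by rewrite [X in X + _]splice_measure_on subrr mul0e add0e.
Qed.

Lemma bend_cost (chi k : R -> R) (s0 s2 kap : R) (kap0 : (0 <= kap)%R)
    (kap1 : (0 <= 1 - kap)%R) :
  (0 <= s0)%R -> (s0 <= s2)%R -> (s2 <= 1)%R ->
  leb.-integrable `[0%R, 1%R] (EFin \o k) ->
  (forall u, (s0 <= u <= s2)%R ->
    (\int[leb]_(s in `]s0, u]) k s = chi u - psi s0)%R) ->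
  chi s2 = psi s2 ->
  (forall u, (s0 < u <= s2)%R -> (0 < psi u)%R) ->
  exists g' mup' mdn', decomposition (bend psi chi s0 s2 kap) g' mup' mdn' /\
  (forall A : borel, measurable A -> A `&` [set` `]s0, s2]] = set0 ->
    cost I thd thu (bend psi chi s0 s2 kap) g' mup' mdn' A =
    cost I thd thu psi g mup mdn A) /\
  cost I thd thu (bend psi chi s0 s2 kap) g' mup' mdn' [set` `[0%R, 1%R]]
    + kap%:E * cost I thd thu psi g mup mdn [set` `]s0, s2]] <=
  cost I thd thu psi g mup mdn [set` `[0%R, 1%R]]
    + kap%:E * \int[leb]_(s in `]s0, s2]) I (k s).
Proof.
move=> s00 s02 s21 ik chiE chi2 psi0.
have D' := bend_decomposition kap1 s00 s02 s21 ik chiE chi2.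
eexists _, _, _; split; first exact: D'.
set B : borel := [set` `]s0, s2]].
pose mB : measurable B := measurable_itvR `]s0, s2].
have B01 : B `<=` [set` `[0%R, 1%R : R]].
  by apply: subset_itv; rewrite bnd_simp.
have off (A : borel) : measurable A -> A `&` B = set0 ->
    cost I thd thu (bend psi chi s0 s2 kap) (splice_density g k kap B)
     (splice_measure mup kap1 mB) (splice_measure mdn kap1 mB) A =
    cost I thd thu psi g mup mdn A.
  move=> mA AB; apply: (splice_cost_off I thd thu g k kap1 mup mdn mB mA AB) => s As.
  apply: bend_outside; apply/negP => Bs.
  have : (A `&` B) s by split => //; rewrite /B /= in_itv.
  by rewrite AB.
split; first exact: off.
pose C : borel := [set` `[0%R, 1%R]] `\` B.
have mC : measurable C by apply: measurableD => //; exact: measurable_itvR.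
have E01 : [set` `[0%R, 1%R]] = B `|` C by rewrite /C setDUK.
have C01 : C `<=` [set` `[0%R, 1%R : R]] by move=> x [].
have CB : C `&` B = set0 by rewrite /C setDKI.
have BC : [disjoint B & C] by apply/disj_set2P; rewrite setIC.
rewrite E01 (costU thd thu I_ge0 mI D')// (costU thd thu I_ge0 mI D)//.
rewrite (off C mC CB).
rewrite addeAC [leRHS]addeAC; apply: leeD => //.
have mk : measurable_fun ([set` `[0%R, 1%R]] : borel) k.
  by apply/measurable_EFinP; exact: measurable_int ik.
have psiB s : B s -> (0 < psi s)%R.
  by rewrite /B /= in_itv/=; exact: psi0.
have le := splice_cost_on I_ge0 mI I_convex thd_ge0 thu_ge0 kap0 kap1 mB B01 D
  (decomposition_measurable D') mk psiB.
apply: le_trans (leeD le (lexx _)) _.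
by rewrite addeAC -ge0_muleDl ?lee_fin// -EFinD subrK mul1e.
Qed.

End competitor.

(** * Minimality against the competing paths *)

Section optimality.
Context {R : realType}.
Local Notation leb := (@lebesgue_measure R).
Local Notation borel := (set (measurableTypeR R)).
Local Notation fmeasure := {finite_measure set (measurableTypeR R) -> \bar R}.

Definition tail (tau sig y delta : R) : R -> R :=
  (fun t => y - delta * (t - tau)) \_ `]-oo, sig[.

Lemma integrable_affine (a c : R) :
  leb.-integrable `[0, 1] (EFin \o (fun t => a + c * t)).
Proof.
apply: continuous_compact_integrable; first exact: segment_compact.
apply: continuous_subspaceT => x.
by apply: cvgD; [exact: cvg_cst|apply: cvgM; [exact: cvg_cst|exact: cvg_id]].
Qed.

Lemma integrable_tail (tau sig y delta : R) :
  leb.-integrable `[0, 1] (EFin \o tail tau sig y delta).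
Proof.
have ia : leb.-integrable `[0, 1] (EFin \o (fun t => y - delta * (t - tau))).
  rewrite (_ : (fun t => _) = (fun t => (y + delta * tau) + (- delta) * t)).
    exact: integrable_affine.
  by apply/funext => t; ring.
rewrite /tail -restrict_EFin; apply/integrable_restrict => //.
apply: integrableS ia => //.
by apply: measurableI; exact: measurable_itvR.
Qed.

Lemma area_competitor (psi chi : R -> R) (s0 s2 kap tau sig y delta : R) :
  0 <= s0 -> s0 <= s2 -> s2 < tau -> tau <= 1 ->
  leb.-integrable `[0, 1] (EFin \o psi) ->
  leb.-integrable `[0, 1] (EFin \o chi) ->
  leb.-integrable `[0, 1]
    (EFin \o descend (bend psi chi s0 s2 kap) tau sig y delta) /\
  \int[leb]_(t in `[0, 1]) descend (bend psi chi s0 s2 kap) tau sig y delta t =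
  \int[leb]_(t in `[0, 1]) psi t
  + kap * \int[leb]_(t in `]s0, s2]) (chi t - psi t)
  + \int[leb]_(t in `[tau, 1]) (tail tau sig y delta t - psi t).
Proof.
move=> s00 s02 s2tau tau1 ipsi ichi.
pose B1 : borel := [set` `]s0, s2]]; pose B2 : borel := [set` `[tau, 1]].
have mB1 : measurable B1 by exact: measurable_itvR.
have mB2 : measurable B2 by exact: measurable_itvR.
have s21 := le_trans (ltW s2tau) tau1.
have tau0 := le_lt_trans (le_trans s00 s02) s2tau.
have B101 : B1 `<=` `[0, 1] by apply: subset_itv; rewrite bnd_simp.
have B201 : B2 `<=` `[0, 1] by apply: subset_itvr; rewrite bnd_simp ltW.
have isub (f h : R -> R) : leb.-integrable `[0, 1] (EFin \o f) ->
    leb.-integrable `[0, 1] (EFin \o h) ->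
    leb.-integrable `[0, 1] (EFin \o (fun t => f t - h t)).
  move=> fi hi; rewrite (_ : EFin \o _ = ((EFin \o f) \- (EFin \o h))%E)//.
  exact: integrableB.
have i1 := isub _ _ ichi ipsi.
have i2 := isub _ _ (integrable_tail tau sig y delta) ipsi.
have ipatch (B : borel) (f : R -> R) : measurable B -> B `<=` `[0, 1] ->
    leb.-integrable `[0, 1] (EFin \o f) ->
    leb.-integrable `[0, 1] (EFin \o (f \_ B)).
  move=> mB B01 fi; rewrite -restrict_EFin; apply/integrable_restrict => //.
  by rewrite setIidr//; apply: integrableS fi.
pose d1 (t : R) : R := chi t - psi t.
pose d2 (t : R) : R := tail tau sig y delta t - psi t.
pose f1 (t : R) : R := kap * (d1 \_ B1) t.
pose f2 : R -> R := d2 \_ B2.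
have if1 : leb.-integrable `[0, 1] (EFin \o f1).
  rewrite (_ : EFin \o f1 =
    (fun t => kap%:E * (EFin \o (d1 \_ B1)) t)%E)//.
  by apply: integrableZl => //; exact: ipatch.
have if2 : leb.-integrable `[0, 1] (EFin \o f2) by exact: ipatch.
have iadd (f h : R -> R) : leb.-integrable `[0, 1] (EFin \o f) ->
    leb.-integrable `[0, 1] (EFin \o h) ->
    leb.-integrable `[0, 1] (EFin \o (fun t => f t + h t)).
  move=> fi hi; rewrite (_ : EFin \o _ = ((EFin \o f) \+ (EFin \o h))%E)//.
  exact: integrableD.
have E : {in ([set` `[0, 1]] : borel),
    (fun t => psi t + f1 t + f2 t) =1
    descend (bend psi chi s0 s2 kap) tau sig y delta}.
  move=> t; rewrite inE/= in_itv/= => /andP[t0 t1].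
  rewrite /f1 /f2 !patchE /d1 /d2 /descend /bend /B1 /B2 /tail
    !mem_setE !in_itv/= t1 andbT.
  rewrite -![point]/(0 : R).
  have [ttau|taut] := ltP t tau; first by case: ifP => _; ring.
  rewrite (lt_geF (lt_le_trans s2tau taut)) andbF patchE.
  rewrite mem_setE in_itv/= -?[point]/(0 : R).
  by case: ifP => _; ring.
split.
  apply: eq_integrable (iadd _ _ (iadd _ _ ipsi if1) if2) => // t t01.
  by rewrite /= -E.
rewrite -(eq_Rintegral _ E) RintegralD//; last exact: iadd.
rewrite RintegralD//; congr (_ + _ + _).
  rewrite RintegralZl//; last by apply: ipatch.
  by rewrite -Rintegral_mkcondr setIidr.
by rewrite -Rintegral_mkcondr setIidr.
Qed.

Local Open Scope ereal_scope.
Variables (I : R -> \bar R) (thd thu : \bar R).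
Hypotheses (I_ge0 : forall y, 0 <= I y) (mI : measurable_fun [set: R] I).
Hypotheses (I_convex : convex_ereal I) (thd_ge0 : 0 <= thd) (thu_ge0 : 0 <= thu).

Definition value (psi : R -> R) : \bar R :=
  ereal_inf [set v | exists g mup mdn, decomposition psi g mup mdn /\
    v = cost I thd thu psi g mup mdn [set` `[0%R, 1%R]]].

Variables (z : R) (psi : R -> R).
Hypotheses (psi_feas : feasible z psi) (psi_fin : value psi < +oo).
Hypothesis psi_min : forall phi, feasible z phi -> value psi <= value phi.

Lemma value_ge0 phi : 0 <= value phi.
Proof.
apply: le_ereal_inf_tmp => _ [g [mup [mdn [_ ->]]]]; exact: cost_ge0.
Qed.

Lemma near_optimal_decomposition (e : R) : (0 < e)%R ->
  exists g mup mdn, decomposition psi g mup mdn /\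
    cost I thd thu psi g mup mdn [set` `[0%R, 1%R]] < value psi + e%:E.
Proof.
move=> e0; have fin : value psi \is a fin_num by rewrite ge0_fin_numE ?value_ge0.
have [_ [g [mup [mdn [D ->]]]] lt] := lb_ereal_inf_adherent e0 fin.
by exists g, mup, mdn.
Qed.

Lemma optimal_integrable : leb.-integrable `[0%R, 1%R] (EFin \o psi).
Proof.
have [g [mup [mdn [D _]]]] := near_optimal_decomposition ltr01.
have mpsi := decomposition_measurable D.
have [[_ psi0] area] := psi_feas.
apply/integrableP; split; first exact/measurable_EFinP.
rewrite [X in X < _](_ : _ = z%:E) ?ltry// -area.
apply: eq_integral => t /set_mem/=.
by rewrite in_itv/= => t01; rewrite ger0_norm ?psi0.
Qed.

(** Compare a nearly optimal decomposition of the minimiser with the path that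
    descends from [tau] on and is bent on [`]s0, s2]] to restore the area. The
    error [e] is there because the value is an infimum; the inequality is stated
    for some decomposition, and lower bounds valid for all decompositions are
    applied to it afterwards. *)
Lemma optimality_inequality (chi k : R -> R)
    (s0 s2 kap tau sig y delta e : R) :
  (0 <= s0)%R -> (s0 <= s2)%R -> (s2 < tau)%R -> (tau <= 1)%R ->
  (tau <= sig)%R -> (0 <= kap <= 1)%R ->
  leb.-integrable `[0%R, 1%R] (EFin \o k) ->
  leb.-integrable `[0%R, 1%R] (EFin \o chi) ->
  (forall u, (s0 <= u <= s2)%R ->
    (\int[leb]_(s in `]s0, u]) k s)%R = (chi u - psi s0)%R) ->
  chi s2 = psi s2 ->
  (forall u, (s0 < u <= s2)%R -> (0 < psi u)%R) ->
  (forall u, (s0 < u <= s2)%R -> (0 <= chi u)%R) ->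
  psi s @[s --> tau^'-] --> y ->
  I (- delta) = 0 -> (0 <= delta)%R ->
  (0 <= y - delta * (sig - tau))%R ->
  (sig <= 1 \/ y - delta * (sig - tau) = 0)%R ->
  (kap * (\int[leb]_(t in `]s0, s2]) (chi t - psi t)) +
    \int[leb]_(t in `[tau, 1%R]) (tail tau sig y delta t - psi t) = 0)%R ->
  (0 < e)%R ->
  exists g mup mdn, [/\ decomposition psi g mup mdn,
    cost I thd thu psi g mup mdn [set` `[0%R, 1%R]] < +oo &
    cost I thd thu psi g mup mdn [set` `[tau, 1%R]] +
      kap%:E * cost I thd thu psi g mup mdn [set` `]s0, s2]] <=
    kap%:E * \int[leb]_(s in `]s0, s2]) I (k s)
      + thd * (y - delta * (sig - tau))%:E + e%:E].
Proof.
move=> s00 s02 s2tau tau1 tsig /andP[kap0 kap1] ik ichi chiE chi2 psi0 chi0.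
move=> psiy Id delta0 j0 sigj area0 e0.
have [g [mup [mdn [D lt]]]] := near_optimal_decomposition e0.
have fin : value psi \is a fin_num by rewrite ge0_fin_numE ?value_ge0.
exists g, mup, mdn; split => //.
  by apply: lt_le_trans lt (leey _).
have s21 := le_trans (ltW s2tau) tau1.
have tau0 := le_lt_trans (le_trans s00 s02) s2tau.
have kap1' : (0 <= 1 - kap)%R by rewrite subr_ge0.
have [g1 [mup1 [mdn1 [D1 [off bendc]]]]] := bend_cost D I_ge0 mI I_convex
  thd_ge0 thu_ge0 kap0 kap1' s00 s02 s21 ik chiE chi2 psi0.
have psiy1 : bend psi chi s0 s2 kap s @[s --> tau^'-] --> y.
  apply: cvg_trans psiy; apply: near_eq_cvg; near=> s.
  rewrite bend_outside// negb_and -!ltNge; apply/orP; right.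
  by near: s; exact: nbhs_left_gt.
have [g2 [mup2 [mdn2 [D2 descc]]]] := descend_cost D1 thd thu I_ge0 mI j0
  tau0 tau1 tsig psiy1 sigj Id.
set phi := descend _ _ _ _ _ in D2 descc.
have [iphi area] := @area_competitor psi chi s0 s2 kap tau sig y delta
  s00 s02 s2tau tau1 optimal_integrable ichi.
have [[_ psi_ge0] psi_area] := psi_feas.
have phi_feas : feasible z phi.
  split; last first.
    rewrite -psi_area -[LHS]fineK; last exact: integrable_fin_num.
    rewrite -[RHS]fineK; last exact: integrable_fin_num optimal_integrable.
    congr EFin; have := area; rewrite -addrA area0 addr0.
    exact.
  split; first exact: decomposition_finite_variation D2.
  move=> t t01; rewrite /phi /descend; have [ttau|taut] := ltP t tau.
    rewrite /bend; case: ifPn => [sts|_]; last by rewrite addr0 psi_ge0.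
    rewrite (_ : _ + _ = (1 - kap) * psi t + kap * chi t)%R; last by ring.
    by apply: addr_ge0; apply: mulr_ge0 => //; [exact: psi_ge0|exact: chi0].
  case: ltP => // tsg; apply: le_trans j0 _.
  by rewrite lerD2l lerN2 ler_wpM2l// lerD2r ltW.
have := psi_min phi_feas.
have : value phi <= cost I thd thu phi g2 mup2 mdn2 [set` `[0%R, 1%R]].
  by apply: ereal_inf_lbound; exists g2, mup2, mdn2.
move=> /[swap] /le_trans/[apply] Jle.
have mtau : measurable ([set` `[tau, 1%R]] : borel) by exact: measurable_itvR.
have offtau := off _ mtau _.
rewrite offtau in descc; last first.
  apply/seteqP; split => // x [] /=; rewrite !in_itv/= => /andP[tx _] /andP[_ xs].
  by have := lt_le_trans s2tau (le_trans tx xs); rewrite ltxx.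
set ct := cost I thd thu psi g mup mdn [set` `[tau, 1%R]] in descc *.
set cb := cost I thd thu psi g mup mdn _ in bendc *.
set C := cost I thd thu psi g mup mdn [set` `[0%R, 1%R]] in lt bendc.
set C1 := cost I thd thu (bend _ _ _ _ _) _ _ _ _ in bendc descc.
set ik' := integral _ _ _ in bendc *.
rewrite -(leeD2lE _ _ fin).
apply: (@le_trans _ _ (C1 + thd * (y - delta * (sig - tau))%:E + kap%:E * cb)).
  rewrite addeA; apply: leeD => //; apply: le_trans descc; exact: leeD.
rewrite addeAC; apply: le_trans (leeD bendc (lexx _)) _.
rewrite -[leLHS]addeA addeC [leRHS]addeCA; apply: leeD => //.
exact: ltW.
Unshelve. all: by end_near. Qed.

End optimality.

(** * Supporting lines of the rate function *)

Section supporting_lines.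
Context {R : realType}.
Variable (I : R -> \bar R).
Hypotheses (I_ge0 : forall y, (0 <= I y)%E) (I_convex : convex_ereal I).

Lemma directional_derive (f : R -> R) (v p w : R) :
  is_derive v 1 f p -> h^-1 * (f (h * w + v) - f v) @[h --> 0^'] --> p * w.
Proof.
move=> [dv dE]; have df : differentiable f v by exact/derivable1_diffP.
have := @diff_derivable _ _ _ f v w df.
rewrite /derivable => /cvg_ex[/= l hl].
suff <- : l = p * w by [].
have -> : l = 'D_w f v by apply/esym/cvg_lim => //.
rewrite deriveE// -[w in LHS]mulr1 -[w * 1]/(w *: 1) linearZ/= -deriveE// dE.
by rewrite mulrC.
Qed.

(** A difference quotient of a convex function is bounded by its chord slope, and
    the derivative is the limit of these quotients. *)
Lemma gradient_supporting_line (v p y : R) : is_gradient I v p ->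
  ((fine (I v) + p * (y - v))%:E <= I y)%E.
Proof.
move=> [Ifin dI].
have Iv : I v \is a fin_num by exact: nbhs_singleton Ifin.
case E : (I y) => [r| |]; last 2 first.
- by rewrite leey.
- by have := I_ge0 y; rewrite E.
have H := @directional_derive (fine \o I) v p (y - v) dI.
have H' := cvg_dnbhs_at_right H.
rewrite lee_fin -lerBrDl.
suff : p * (y - v) <= r - fine (I v) by [].
rewrite -(cvg_lim (@norm_hausdorff _ R) H'); apply: limr_le.
  by apply/cvg_ex; eexists; exact: H'.
near=> h; have h0 : 0 < h by near: h; exact: nbhs_right_gt.
have h1 : h < 1 by near: h; exact: nbhs_right_lt.
rewrite mulrC ler_pdivrMr//.
have := @I_convex y v h; rewrite (ltW h0) (ltW h1) => /(_ isT).
rewrite E -(fineK Iv) -!EFinM -EFinD.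
rewrite (_ : h * y + (1 - h) * v = h * (y - v) + v); last by ring.
move=> le; have fin : I (h * (y - v) + v) \is a fin_num.
  by rewrite ge0_fin_numE//; apply: le_lt_trans le (ltry _).
move: le; rewrite -(fineK fin) lee_fin /= => le.
by rewrite lerBlDr; apply: le_trans le _; rewrite le_eqVlt; apply/orP; left;
  apply/eqP; ring.
Unshelve. all: by end_near. Qed.

Lemma gradient_fin (v p : R) : is_gradient I v p -> I v = (fine (I v))%:E.
Proof. by move=> [Ifin _]; rewrite fineK//; exact: nbhs_singleton Ifin. Qed.

(** Add the two supporting inequalities. Equality of the two points is excluded
    because the derivative at a point is unique. *)
Lemma gradient_monotone (v v' p p' : R) :
  is_gradient I v p -> is_gradient I v' p' -> p' < p -> v' < v.
Proof.
move=> g g' pp.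
have := gradient_supporting_line v' g.
rewrite [leRHS](gradient_fin g') lee_fin => le1.
have := gradient_supporting_line v g'.
rewrite [leRHS](gradient_fin g) lee_fin => le2.
have le3 : (p - p') * (v' - v) <= 0 by nra.
have : v' <= v by rewrite -subr_le0 -(pmulr_rle0 _ (_ : 0 < p - p')) ?subr_gt0.
rewrite le_eqVlt => /predU1P[vv|//].
move: g g' pp; rewrite vv => -[_ [_ <-]] [_ [_ <-]].
by rewrite ltxx.
Qed.

Variable delta : R.
Hypotheses (delta_gt0 : 0 < delta) (I_delta : I (- delta) = 0%E).
Hypothesis delta_least : forall d', 0 < d' -> I (- d') = 0%E -> delta <= d'.

(** A nonnegative zero of the rate would, by convexity, make [- delta / 2] a zero
    as well, against the minimality of [delta]. *)
Lemma rate_gt0 (y : R) : - delta < y -> (0 < I y)%E.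
Proof.
move=> dy; rewrite lt_neqAle I_ge0 andbT; apply/negP => /eqP Iy.
have [y0|y0] := ltP y 0.
  have := @delta_least (- y); rewrite opprK oppr_gt0 => /(_ y0 (esym Iy)).
  by rewrite lerNr leNgt dy.
have yd : 0 < y + delta by rewrite addrC -ltrBlDl sub0r.
(* the point [- delta / 2] lies between the zeros [- delta] and [y] *)
pose t := (y + delta / 2) / (y + delta).
have t01 : 0 <= t <= 1.
  apply/andP; split; first by rewrite divr_ge0 ?ltW// ltr_wpDl// divr_gt0.
  rewrite ler_pdivrMr// mul1r lerD2l ler_pdivrMr// ler_peMr ?ler1n// ltW//.
have := @I_convex (- delta) y t t01.
rewrite I_delta -Iy !mule0 adde0.
rewrite (_ : _ + _ = - (delta / 2)); last first.
  by rewrite /t; field; rewrite gt_eqF.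
move=> le0; have I0 : I (- (delta / 2)) = 0%E.
  by apply/eqP; rewrite eq_le le0 I_ge0.
have := delta_least (divr_gt0 delta_gt0 (ltr0n _ 2)) I0.
by rewrite leNgt ltr_pdivrMr// ltr_pMr// ltr1n.
Qed.

(** The chord slope from the zero [- delta] is nondecreasing. *)
Lemma rate_ratio (u w : R) : - delta < u -> u <= w -> I w \is a fin_num ->
  I u \is a fin_num /\
  fine (I u) / (u + delta) * (w + delta) <= fine (I w).
Proof.
move=> du uw Iw.
have ud : 0 < u + delta by rewrite addrC -ltrBlDl sub0r.
have wd : 0 < w + delta by apply: lt_le_trans ud _; rewrite lerD2r.
pose t := (u + delta) / (w + delta).
have t01 : 0 <= t <= 1.
  apply/andP; split; first by apply: divr_ge0; exact: ltW.
  by rewrite ler_pdivrMr// mul1r lerD2r.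
have := @I_convex w (- delta) t t01.
rewrite I_delta mule0 adde0 -(fineK Iw) -EFinM.
rewrite (_ : t * w + (1 - t) * - delta = u); last by rewrite /t; field; rewrite gt_eqF.
move=> le; have Iu : I u \is a fin_num.
  by rewrite ge0_fin_numE//; apply: le_lt_trans le (ltry _).
split => //; move: le; rewrite -(fineK Iu) lee_fin/= => le.
rewrite mulrAC ler_pdivrMr// -ler_pdivlMr//; apply: le_trans le _.
by rewrite /t mulrC mulrA.
Qed.

End supporting_lines.

Section cramer.
Context {R : realType}.
Variable Lam : R -> \bar R.
Local Open Scope ereal_scope.

(** Only exponents [th] with finite [Lam th] contribute to the supremum defining
    the rate, and they are at most [theta_up]; hence the rate grows by at most
    [theta_up] over an interval of length one. *)
Lemma supporting_slope_le_theta_up (r p w : R) :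
  0 < theta_up Lam -> rate Lam w = r%:E ->
  (forall y, (r + p * (y - w))%:E <= rate Lam y) -> p%:E <= theta_up Lam.
Proof.
move=> up0 Iw supp; rewrite leNgt; apply/negP => lt.
have fin : theta_up Lam \is a fin_num.
  by rewrite ge0_fin_numE ?(ltW up0)//; exact: lt_trans lt (ltry _).
pose c := fine (theta_up Lam).
have := supp (w + 1)%R; rewrite [(w + 1)%R in X in X <= _ -> _]addrC addrK mulr1.
apply/negP; rewrite -ltNge.
apply: (@le_lt_trans _ _ (c + r)%:E); last first.
  by rewrite lte_fin addrC ltrD2l -lte_fin fineK.
apply: ge_ereal_sup => _ [th _ <-].
have [->|Lth] := eqVneq (Lam th) +oo.
  by rewrite /= leNye.
have thc : (th <= c)%R.
  have [th0|th0] := ltP 0%R th.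
    rewrite -lee_fin /c fineK//; apply: ereal_sup_ubound.
    by exists th => //; split => //; rewrite ltey.
  by apply: le_trans th0 _; rewrite /c fine_ge0// ltW.
rewrite (_ : th * (w + 1) = th + th * w)%R; last by ring.
rewrite !EFinD -addeA; apply: leeD.
  by rewrite lee_fin.
by rewrite -Iw; apply: ereal_sup_ubound; exists th.
Qed.

Lemma supporting_slope_ge_theta_down (r p w : R) :
  0 < theta_down Lam -> rate Lam w = r%:E ->
  (forall y, (r + p * (y - w))%:E <= rate Lam y) ->
  (- p)%:E <= theta_down Lam.
Proof.
move=> dn0 Iw supp; rewrite leNgt; apply/negP => lt.
have fin : theta_down Lam \is a fin_num.
  by rewrite ge0_fin_numE ?(ltW dn0)//; exact: lt_trans lt (ltry _).
pose c := fine (theta_down Lam).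
have := supp (w - 1)%R; rewrite [(w - 1)%R in X in X <= _ -> _]addrC addrK mulrN1.
apply/negP; rewrite -ltNge.
apply: (@le_lt_trans _ _ (c + r)%:E); last first.
  by rewrite lte_fin addrC ltrD2l -lte_fin fineK.
apply: ge_ereal_sup => _ [th _ <-].
have [->|Lth] := eqVneq (Lam th) +oo.
  by rewrite /= leNye.
have thc : (- th <= c)%R.
  have [th0|th0] := ltP 0%R (- th)%R.
    rewrite -lee_fin /c fineK//; apply: ereal_sup_ubound.
    by exists (- th)%R => //=; rewrite opprK ltey.
  by apply: le_trans th0 _; rewrite /c fine_ge0// ltW.
rewrite (_ : th * (w - 1) = - th + th * w)%R; last by ring.
rewrite !EFinD -addeA; apply: leeD.
  by rewrite lee_fin.
by rewrite -Iw; apply: ereal_sup_ubound; exists th.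
Qed.

End cramer.

(** * Concave arcs and bounds on integrals *)

Section concave_arc.
Context {R : realType}.
Variables (psi v : R -> R) (S T : R).
Hypothesis dpsi : forall t, S < t < T -> is_derive t 1 psi (v t).
Hypothesis vdec : forall s t, S < s -> s < t -> t < T -> v t < v s.

Lemma arc_continuous t : S < t < T -> {for t, continuous psi}.
Proof.
move=> /dpsi [dt _]; apply: differentiable_continuous.
exact/derivable1_diffP.
Qed.

Lemma arc_mvt s t : S < s -> s < t -> t < T ->
  exists2 c, s < c < t & psi t - psi s = v c * (t - s).
Proof.
move=> Ss st tT; have [c| |c cst ->] := @MVT R psi v s t st.
- by rewrite in_itv/= => /andP[sc ct]; apply: dpsi; rewrite (lt_trans Ss)//=; lra.
- apply: derivable_within_continuous => c; rewrite in_itv/= => /andP[sc ct].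
  by have [|//] := @dpsi c; apply/andP; split; lra.
- by exists c.
Qed.

Lemma arc_mvt_end s : psi t @[t --> T^'-] --> psi T -> S < s -> s < T ->
  exists2 c, s < c < T & psi T - psi s = v c * (T - s).
Proof.
move=> psiT Ss sT; have [c| |c cst ->] := @MVT R psi v s T sT.
- by rewrite in_itv/= => /andP[sc ct]; apply: dpsi; rewrite (lt_trans Ss).
- apply/continuous_within_itvP => //; split => //.
  + move=> c; rewrite in_itv/= => /andP[sc ct].
    by apply: arc_continuous; rewrite (lt_trans Ss).
  + apply: cvg_at_right_filter; apply: arc_continuous.
    by rewrite Ss.
- by exists c.
Qed.

(** At a zero inside the arc the slope would be nonpositive, as the path comes
    down to its minimum, and strictly negative afterwards. *)
Lemma arc_gt0 t : (forall u, S < u < T -> 0 <= psi u) -> S < t < T -> 0 < psi t.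
Proof.
move=> psi0 /andP[St tT]; rewrite lt_neqAle psi0 ?St// andbT.
apply/negP => /eqP pt.
pose s := (S + t) / 2; pose u := (t + T) / 2.
have [c /andP[sc ct] e1] : exists2 c, s < c < t & psi t - psi s = v c * (t - s).
  by apply: arc_mvt; rewrite /s; lra.
have [c' /andP[tc cu] e2] : exists2 c, t < c < u & psi u - psi t = v c * (u - t).
  by apply: arc_mvt; rewrite /u; lra.
have ps : 0 <= psi s by apply: psi0; rewrite /s; lra.
have pu : 0 <= psi u by apply: psi0; rewrite /u; lra.
have vv : v c' < v c by apply: vdec; rewrite /s /u in sc cu *; lra.
have st : 0 < t - s by rewrite /s; lra.
have tu : 0 < u - t by rewrite /u; lra.
have vc : v c <= 0 by rewrite -(pmulr_lle0 _ st) -e1; lra.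
have : v c' * (u - t) < 0 by rewrite pmulr_llt0//; lra.
lra.
Qed.

Lemma chord_below s0 s2 w t : S < s0 -> s2 < T -> s0 < t -> t < s2 ->
  psi s2 - psi s0 = w * (s2 - s0) -> psi s0 + w * (t - s0) < psi t.
Proof.
move=> Ss0 s2T s0t ts2 e.
have [c /andP[sc ct] e1] := arc_mvt Ss0 s0t (lt_trans ts2 s2T).
have [c' /andP[tc cu] e2] := arc_mvt (lt_trans Ss0 s0t) ts2 s2T.
have vv : v c' < v c by apply: vdec; lra.
have wv : w < v c.
  rewrite -(ltr_pM2r (_ : 0 < s2 - s0)); last by lra.
  rewrite -e (_ : psi s2 - psi s0 = v c' * (s2 - t) + v c * (t - s0)).
    by nra.
  by lra.
have : w * (t - s0) < v c * (t - s0) by rewrite ltr_pM2r// subr_gt0.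
lra.
Qed.

(** The tangent line at [s0] up to [s1], continued with the slope at [s2]; for the
    [s1] of [tent_apex] the second piece is the tangent line at [s2]. *)
Definition tent s0 s1 s2 t : R :=
  psi s0 + v s0 * (Num.min t s1 - s0) + v s2 * (Num.max t s1 - s1).

Lemma tent_apex s0 s2 : S < s0 -> s0 < s2 -> s2 < T ->
  exists2 s1, s0 < s1 < s2 & tent s0 s1 s2 s2 = psi s2.
Proof.
move=> Ss0 s02 s2T.
have [c /andP[sc cs] e] := arc_mvt Ss0 s02 s2T.
have v0 : v c < v s0 by apply: vdec => //; exact: lt_trans s2T.
have v2 : v s2 < v c by apply: vdec => //; exact: lt_trans sc.
have v02 : 0 < v s0 - v s2 by lra.
pose s1 := (psi s2 - psi s0 + v s0 * s0 - v s2 * s2) / (v s0 - v s2).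
have s1E : s1 * (v s0 - v s2) = psi s2 - psi s0 + v s0 * s0 - v s2 * s2.
  by rewrite /s1 mulfVK// gt_eqF.
have s01 : s0 < s1.
  rewrite -(ltr_pM2r v02) s1E e.
  have : 0 < (v c - v s2) * (s2 - s0) by rewrite mulr_gt0 ?subr_gt0.
  by lra.
have s12 : s1 < s2.
  rewrite -(ltr_pM2r v02) s1E e.
  have : 0 < (v s0 - v c) * (s2 - s0) by rewrite mulr_gt0 ?subr_gt0.
  by lra.
exists s1; first by rewrite s01.
rewrite /tent (min_idPr (ltW s12)) (max_idPl (ltW s12)).
by lra.
Qed.

Lemma tent_above s0 s1 s2 t : S < s0 -> s2 < T -> s0 < t -> t < s2 ->
  tent s0 s1 s2 s2 = psi s2 -> s1 < s2 -> psi t < tent s0 s1 s2 t.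
Proof.
move=> Ss0 s2T s0t ts2 e s12.
have [ts1|s1t] := leP t s1.
  have [c /andP[sc ct] e1] := arc_mvt Ss0 s0t (lt_trans ts2 s2T).
  rewrite /tent (min_idPl ts1) (max_idPr ts1) subrr mulr0 addr0.
  have vv : v c < v s0 by apply: vdec => //; lra.
  have : v c * (t - s0) < v s0 * (t - s0) by rewrite ltr_pM2r// subr_gt0.
  by lra.
have [c /andP[tc cu] e2] := arc_mvt (lt_trans Ss0 s0t) ts2 s2T.
move: e; rewrite /tent (min_idPr (ltW s12)) (max_idPl (ltW s12)).
rewrite (min_idPr (ltW s1t)) (max_idPl (ltW s1t)) => e.
have vv : v s2 < v c by apply: vdec => //; lra.
have : v s2 * (s2 - t) < v c * (s2 - t) by rewrite ltr_pM2r// subr_gt0.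
lra.
Qed.

End concave_arc.

Section integral_bounds.
Context {R : realType}.
Local Notation leb := (@lebesgue_measure R).

Lemma Rintegral_itv_cst (a b c : R) : a <= b ->
  \int[leb]_(t in `[a, b]) c = c * (b - a).
Proof.
move=> ab; rewrite Rintegral_cst//; congr (_ * _).
rewrite [X in fine X]lebesgue_measure_itv/= lte_fin.
by move: ab; rewrite le_eqVlt => /predU1P[->|->//]; rewrite ltxx subrr.
Qed.

Lemma integrable_itv_cst (a b c : R) :
  leb.-integrable `[a, b] (EFin \o (fun=> c)).
Proof.
have finA : (leb `[a, b] < +oo)%E.
  by rewrite lebesgue_measure_itv/=; case: ifP => _; rewrite -?EFinB ltry.
by apply: measurable_bounded_integrable => //; exact: bounded_cst.
Qed.

Lemma Rintegral_oc_gt0 (a b : R) (f : R -> R) : a < b ->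
  leb.-integrable `]a, b] (EFin \o f) ->
  (forall t, a < t < b -> 0 < f t) -> 0 < \int[leb]_(t in `]a, b]) f t.
Proof.
move=> ab fi f0.
have sub : `]a, b[%classic `<=` `]a, b]%classic.
  by apply: subset_itvl; rewrite bnd_simp.
have fio : leb.-integrable `]a, b[ (EFin \o f) by apply: integrableS fi.
rewrite -Rintegral_itv_bndo_bndc//.
have ge0 : 0 <= \int[leb]_(t in `]a, b[) f t.
  by apply: Rintegral_ge0 => t /=; rewrite in_itv/= => /f0/ltW.
rewrite lt_neqAle ge0 andbT; apply/negP => /eqP int0.
have : (\int[leb]_(t in `]a, b[) `|(EFin \o f) t| = 0)%E.
  transitivity (\int[leb]_(t in `]a, b[) (EFin \o f) t)%E.
    apply: eq_integral => t /set_mem/=; rewrite in_itv/= => /f0/ltW ft.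
    by rewrite ger0_norm.
  rewrite -[LHS]fineK; last exact: integrable_fin_num.
  by rewrite -[fine _]/(\int[leb]_(t in `]a, b[) f t) -int0.
have [h _] := @ae_eq_integral_abs _ _ R leb _ (measurable_itvR `]a, b[)
  (EFin \o f) (measurable_int leb fio).
move=> /h[N [mN N0 sN]].
have : (leb `]a, b[ <= leb N)%E.
  apply: le_measure; rewrite ?inE//.
  move=> t /= tab; apply: sN => /= /(_ tab)[ft].
  by move: tab; rewrite in_itv/= => /f0; rewrite ft ltxx.
rewrite N0 lebesgue_measure_itv/= lte_fin ab -EFinB lee_fin.
by rewrite subr_le0 leNgt ab.
Qed.

Lemma Rintegral_head_le (a x b M : R) (f : R -> R) : a <= x -> x <= b ->
  leb.-integrable `[a, b] (EFin \o f) ->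
  (forall t, a <= t <= x -> f t <= M) -> (forall t, x < t <= b -> f t <= 0) ->
  \int[leb]_(t in `[a, b]) f t <= M * (x - a).
Proof.
move=> ax xb fi fM f0.
have i1 : leb.-integrable `[a, x] (EFin \o f).
  by apply: integrableS fi => //; apply: subset_itvl; rewrite bnd_simp.
have i2 : leb.-integrable `]x, b] (EFin \o f).
  by apply: integrableS fi => //; apply: subset_itvr; rewrite bnd_simp.
have E : [set` `[a, b]] = [set` `[a, x]] `|` [set` `]x, b]] :> set R.
  by rewrite -itv_bndbnd_setU ?bnd_simp.
rewrite E Rintegral_setU//; last 2 first.
- by rewrite -E.
- apply/disj_setPS => t []/=; rewrite !in_itv/= => /andP[_ xt] /andP[tx _].
  by have := lt_le_trans tx xt; rewrite ltxx.
rewrite -[leRHS]addr0; apply: lerD.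
  rewrite -Rintegral_itv_cst//; apply: le_Rintegral => //.
    exact: integrable_itv_cst.
have -> : 0 = \int[leb]_(t in `]x, b]) (0 : R).
  by rewrite Rintegral_cst// mul0r.
apply: le_Rintegral => //.
- have ic := integrable_itv_cst x b 0.
  by apply: integrableS ic => //; apply: subset_itvr; rewrite bnd_simp.
Qed.

End integral_bounds.

(** * The endpoint of an optimal path *)

Section endpoint.
Context {R : realType}.
Local Notation leb := (@lebesgue_measure R).
Local Notation borel := (set (measurableTypeR R)).
Local Notation fmeasure := {finite_measure set (measurableTypeR R) -> \bar R}.

Variables (Lam : R -> \bar R) (delta z : R) (psi : R -> R) (b lam : R).
Local Notation I := (rate Lam).
Local Notation thd := (theta_down Lam).
Local Notation thu := (theta_up Lam).
Local Notation S := (T00 Lam psi).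
Local Notation T := (T1 psi).
Hypotheses (thd_gt0 : (0 < thd)%E) (thu_gt0 : (0 < thu)%E).
Hypotheses (rate_good : good_rate_function I) (rate_convex : convex_ereal I).
Hypotheses (delta_gt0 : 0 < delta) (rate_delta : I (- delta) = 0%E).
Hypothesis delta_least : forall d', 0 < d' -> I (- d') = 0%E -> delta <= d'.
Hypothesis psi_optimal : optimal Lam z psi.
Hypotheses (ST : S < T) (lam_gt0 : 0 < lam).
Hypothesis psi_gradient : affine_gradient Lam psi b lam.

Let I_ge0 y : (0 <= I y)%E. Proof. by case: rate_good. Qed.
Let mI : measurable_fun [set: R] I.
Proof. by case: rate_good => _ ? _; exact: lower_semicontinuous_measurable. Qed.
Let thd_ge0 : (0 <= thd)%E. Proof. exact: ltW. Qed.
Let thu_ge0 : (0 <= thu)%E. Proof. exact: ltW. Qed.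
Local Notation costI := (cost I thd thu).
Local Notation valueI := (value I thd thu).

(** The second term of the integrand vanishes: the infimum of the rate over
    nonpositive slopes is attained at [- delta] and equals zero. *)
Lemma J_value phi : J Lam phi = valueI phi.
Proof.
have inf0 : ereal_inf [set I x | x in [set x : R | x <= 0]] = 0%E.
  apply/eqP; rewrite eq_le; apply/andP; split.
    apply: ereal_inf_lbound; exists (- delta) => //=.
    by rewrite oppr_le0 ltW.
  by apply: le_ereal_inf_tmp => _ [x _ <-].
rewrite /J /path_cost /value inf0; congr ereal_inf.
apply/seteqP; split => _ [g [mup [mdn [D ->]]]]; exists g, mup, mdn;
  split => //; rewrite /cost; congr (_ + _ + _)%E; apply: eq_integral => s _;
  by rewrite mul0e adde0.
Qed.

Let psi_feasible : feasible z psi. Proof. by case: psi_optimal. Qed.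
Let psi_fin : (valueI psi < +oo)%E.
Proof. by case: psi_optimal; rewrite J_value. Qed.
Let psi_min phi : feasible z phi -> (valueI psi <= valueI phi)%E.
Proof. by case: psi_optimal => _ _ h /h; rewrite !J_value. Qed.

Lemma psi_ge0 t : 0 <= t <= 1 -> 0 <= psi t.
Proof. by case: psi_feasible => -[_ h] _; exact: h. Qed.

Lemma times_bounds : 0 <= S /\ T <= 1.
Proof.
have T_le1 : T <= 1.
  have [e|/set0P ne] := eqVneq (positive_times psi) set0.
    by rewrite /T1 e sup0 ler01.
  by apply: ge_sup => // t [/andP[]].
split => //; rewrite /T00; case: asboolP => [_|/eqP/set0P ne].
  have [e|/set0P ne] := eqVneq (positive_times psi) set0.
    by rewrite /T0 e inf0.
  by apply: lb_le_inf => // t [/andP[]].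
have [t [/andP[t0 t1] h]] := ne.
apply: le_trans (ltW t0) _; apply: ub_le_sup; last by split => //; rewrite t0.
by exists 1 => u [/andP[]].
Qed.

Let S_ge0 : 0 <= S. Proof. by case: times_bounds. Qed.
Let T_le1 : T <= 1. Proof. by case: times_bounds. Qed.
Let T_gt0 : 0 < T. Proof. exact: le_lt_trans ST. Qed.

Let range t : S < t -> t < T -> 0 <= t <= 1.
Proof.
move=> St tT; apply/andP; split.
  by apply: le_trans S_ge0 _; exact: ltW.
by apply: le_trans T_le1; exact: ltW.
Qed.

Lemma psi_after t : T < t -> t <= 1 -> psi t = 0.
Proof.
move=> Tt t1; have t0 : 0 <= t by apply: le_trans (ltW Tt); exact: ltW.
apply/eqP; rewrite eq_le psi_ge0 ?t0// andbT leNgt; apply/negP => pt.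
move: Tt; rewrite ltNge => /negP; apply; apply: ub_le_sup.
  by exists 1 => u [/andP[]].
by split => //; rewrite t0.
Qed.

Let v (t : R) : R := 'D_1 psi t.

Lemma psi_derive t : S < t < T -> is_derive t 1 psi (v t).
Proof. by move=> /psi_gradient[w dw _]; split; [case: dw|]. Qed.

Lemma v_gradient t : S < t < T -> is_gradient I (v t) (b - lam * t).
Proof. by move=> /psi_gradient[w [_ <-] gw]. Qed.

Lemma v_decreasing s t : S < s -> s < t -> t < T -> v t < v s.
Proof.
move=> Ss st tT.
apply: gradient_monotone (v_gradient _) (v_gradient _) _ => //.
- by rewrite Ss (lt_trans st).
- by rewrite (lt_trans Ss st).
- by rewrite ltrD2l ltrN2 ltr_pM2l.
Qed.

Lemma psi_gt0 t : S < t < T -> 0 < psi t.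
Proof.
apply: (arc_gt0 psi_derive v_decreasing) => u /andP[Su uT].
by apply: psi_ge0; exact: range.
Qed.

(** Jensen's inequality at a mean slope that is the derivative of the path at some
    time of the arc: there the rate has a gradient, which provides the supporting
    line. *)
Lemma arc_cost g mup mdn s t c : decomposition psi g mup mdn ->
  0 <= s -> s < t -> t <= 1 -> (forall u, s < u < t -> 0 < psi u) ->
  S < c < T -> psi t - psi s = v c * (t - s) ->
  (((t - s) * fine (I (v c)))%:E <= costI psi g mup mdn [set` `]s, t]])%E.
Proof.
move=> D s0 st t1 pos ScT e.
have gr := v_gradient ScT.
have Iv := gradient_fin gr.
have supp y := gradient_supporting_line I_ge0 rate_convex y gr.
apply: (jensen_cost I_ge0 mI D s0 st t1 pos e supp).
  exact: supporting_slope_ge_theta_down Iv supp.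
exact: supporting_slope_le_theta_up Iv supp.
Qed.

Lemma v_fin t : S < t < T -> I (v t) = (fine (I (v t)))%:E.
Proof. by move=> /v_gradient/gradient_fin. Qed.

Lemma left_limit (tau : R) : 0 < tau <= 1 -> exists y,
  [/\ psi s @[s --> tau^'-] --> y, 0 <= y & S < tau < T -> y = psi tau].
Proof.
move=> /[dup] tau01 /andP[tau0 tau1].
have [[[_ cl] _] _] := psi_feasible.1; have /cvg_ex[y yP] := cl tau tau01.
exists y; split => //.
  rewrite -(cvg_lim (@norm_hausdorff _ R) yP); apply: limr_ge.
    by apply/cvg_ex; exists y.
  near=> s; apply: psi_ge0; apply/andP; split.
    by near: s; exact: nbhs_left_ge.
  by apply: le_trans tau1; near: s; exact: nbhs_left_le.
move=> /(arc_continuous psi_derive)/cvg_at_left_filter h.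
exact: (cvg_unique (@norm_hausdorff _ R) yP h).
Unshelve. all: by end_near. Qed.

(** A tail that adds area costs nothing to repair: replacing an arc by its chord
    lowers the area, since the arc is strictly concave, and does not raise the
    cost, by Jensen's inequality. So the cost saved on [`[tau, 1]] is bounded by
    the price of the final jump of the tail. *)
Lemma chord_inequality s0 s2 : S < s0 -> s0 < s2 -> s2 < T ->
  exists2 A : R, 0 < A & forall tau sig y e, s2 < tau -> tau <= 1 -> tau <= sig ->
  psi s @[s --> tau^'-] --> y -> 0 <= y - delta * (sig - tau) ->
  (sig <= 1 \/ y - delta * (sig - tau) = 0) ->
  0 <= \int[leb]_(t in `[tau, 1]) (tail tau sig y delta t - psi t) <= A ->
  0 < e ->
  exists g mup mdn, [/\ decomposition psi g mup mdn,
    (costI psi g mup mdn [set` `[0%R, 1%R]] < +oo)%E &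
    (costI psi g mup mdn [set` `[tau, 1%R]] <=
      thd * (y - delta * (sig - tau))%:E + e%:E)%E].
Proof.
move=> Ss0 s02 s2T.
have /andP[s00 _] := range Ss0 (lt_trans s02 s2T).
have /andP[_ s21] := range (lt_trans Ss0 s02) s2T.
have [c /andP[sc cs] e] := arc_mvt psi_derive Ss0 s02 s2T.
have ScT : S < c < T by apply/andP; split; lra.
pose w := v c; pose chi t := psi s0 + w * (t - s0).
have ipsi := optimal_integrable I_ge0 thd_ge0 thu_ge0 psi_feasible psi_fin.
have ichi : leb.-integrable `[0, 1] (EFin \o chi).
  rewrite (_ : chi = fun t => (psi s0 - w * s0) + w * t).
    exact: integrable_affine.
  by apply/funext => t; rewrite /chi; ring.
have sub01 : `]s0, s2]%classic `<=` `[0, 1]%classic.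
  by apply: subset_itv; rewrite bnd_simp.
have ipsi' : leb.-integrable `]s0, s2] (EFin \o psi) by apply: integrableS ipsi.
have ichi' : leb.-integrable `]s0, s2] (EFin \o chi) by apply: integrableS ichi.
pose A := \int[leb]_(t in `]s0, s2]) (psi t - chi t).
have A0 : 0 < A.
  apply: Rintegral_oc_gt0 => //.
    rewrite (_ : EFin \o _ = ((EFin \o psi) \- (EFin \o chi))%E)//.
    exact: integrableB.
  move=> t /andP[s0t ts2]; rewrite subr_gt0.
  exact: (chord_below psi_derive v_decreasing Ss0 s2T s0t ts2 e).
exists A => // tau sig y eps s2tau tau1 tsig psiy j0 sigj /andP[a0 aA] eps0.
set a := Rintegral _ _ _ in a0 aA.
have areaE : \int[leb]_(t in `]s0, s2]) (chi t - psi t) = - A.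
  by rewrite /A !RintegralB// opprB.
have kap01 : 0 <= a / A <= 1.
  apply/andP; split; first by apply: divr_ge0 => //; exact: ltW.
  by rewrite ler_pdivrMr// mul1r.
have [|||||g [mup [mdn [D fin le]]]] := @optimality_inequality R I thd thu
  I_ge0 mI rate_convex thd_ge0 thu_ge0 z psi psi_feasible psi_fin psi_min chi
  (cst w) s0 s2 (a / A) tau sig y delta eps s00 (ltW s02) s2tau tau1 tsig kap01
  (integrable_itv_cst _ _ _) ichi _ _ _ _ psiy rate_delta (ltW delta_gt0) j0
  sigj _ eps0.
- move=> u /andP[s0u us2]; rewrite Rintegral_cst//.
  rewrite [X in fine X]lebesgue_measure_itv/= lte_fin /chi [RHS]addrAC subrr add0r.
  congr (_ * _); move: s0u; rewrite le_eqVlt => /predU1P[->|->//].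
  by rewrite ltxx subrr.
- by rewrite /chi -e; ring.
- by move=> u /andP[s0u us2]; apply: psi_gt0; apply/andP; split; lra.
- move=> u /andP[s0u us2].
  have p0 : 0 < psi s0 by apply: psi_gt0; apply/andP; split; lra.
  have p2 : 0 < psi s2 by apply: psi_gt0; apply/andP; split; lra.
  rewrite -(pmulr_rge0 _ (_ : 0 < s2 - s0)) ?subr_gt0//.
  rewrite (_ : _ * _ = (s2 - u) * psi s0 + (u - s0) * psi s2).
    by apply: addr_ge0; apply: mulr_ge0; rewrite ?subr_ge0// ltW.
  have -> : psi s2 = psi s0 + w * (s2 - s0) by rewrite -e; ring.
  by rewrite /chi; ring.
- by rewrite areaE mulrN mulfVK ?gt_eqF// addrC subrr.
exists g, mup, mdn; split => //; move: le.
rewrite [X in (_ <= (a / A)%:E * X + _ + _)%E](_ : _ =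
  ((s2 - s0) * fine (I w))%:E); last first.
  rewrite (eq_integral (cst (I w)))// integral_cst//.
  rewrite [X in (_ * X)%E]lebesgue_measure_itv/= lte_fin s02 /w (v_fin ScT).
  by rewrite -EFinB -EFinM mulrC.
move=> le.
have jen : (((s2 - s0) * fine (I w))%:E <= costI psi g mup mdn [set` `]s0, s2]])%E.
  apply: arc_cost D s00 s02 s21 _ ScT e => u /andP[s0u us2].
  by apply: psi_gt0; apply/andP; split; lra.
(* both sides contain the cost of the chord, which is finite *)
have fx : ((a / A)%:E * ((s2 - s0) * fine (I w))%:E)%E \is a fin_num by [].
rewrite -(leeD2lE _ _ fx) [leRHS]addeA; apply: le_trans le; rewrite addeC.
apply: leeD => //.
by apply: lee_wpmul2l => //; rewrite lee_fin; case/andP: kap01.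
Qed.

(** A tail that removes area is repaired by mixing with the tent of tangent lines,
    which lies above the arc and has finite cost; the price is proportional to
    the area to be restored. *)
Lemma tent_inequality s0 s2 : S < s0 -> s0 < s2 -> s2 < T ->
  exists A C : R, [/\ 0 < A, 0 <= C & forall tau sig y e,
  s2 < tau -> tau <= 1 -> tau <= sig ->
  psi s @[s --> tau^'-] --> y -> y - delta * (sig - tau) = 0 ->
  0 <= \int[leb]_(t in `[tau, 1]) (psi t - tail tau sig y delta t) <= A ->
  0 < e ->
  exists g mup mdn, decomposition psi g mup mdn /\
    (costI psi g mup mdn [set` `[tau, 1%R]] <=
      ((\int[leb]_(t in `[tau, 1%R]) (psi t - tail tau sig y delta t))%R
        / A * C + e)%:E)%E].
Proof.
move=> Ss0 s02 s2T.
have /andP[s00 _] := range Ss0 (lt_trans s02 s2T).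
have /andP[_ s21] := range (lt_trans Ss0 s02) s2T.
have [s1 /andP[s01 s12] apex] := tent_apex psi_derive v_decreasing Ss0 s02 s2T.
pose chi := tent psi v s0 s1 s2.
pose w1 := v s0; pose w2 := v s2.
have chiE u : chi u = psi s0 + w2 * (u - s0) + (w1 - w2) * (Num.min u s1 - s0).
  rewrite /chi /tent -/w1 -/w2; case: leP => _; ring.
have ipsi := optimal_integrable I_ge0 thd_ge0 thu_ge0 psi_feasible psi_fin.
have ichi : leb.-integrable `[0, 1] (EFin \o chi).
  apply: continuous_compact_integrable; first exact: segment_compact.
  apply: continuous_subspaceT => x.
  apply: cvgD; [apply: cvgD; first exact: cvg_cst|];
    (apply: cvgM; first exact: cvg_cst).
    apply: cvgB; last exact: cvg_cst.
    by apply: continuous_min; [exact: cvg_id|exact: cvg_cst].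
  apply: cvgB; last exact: cvg_cst.
  by apply: continuous_max; [exact: cvg_id|exact: cvg_cst].
have sub01 : `]s0, s2]%classic `<=` `[0, 1]%classic.
  by apply: subset_itv; rewrite bnd_simp.
have ipsi' : leb.-integrable `]s0, s2] (EFin \o psi) by apply: integrableS ipsi.
have ichi' : leb.-integrable `]s0, s2] (EFin \o chi) by apply: integrableS ichi.
pose A := \int[leb]_(t in `]s0, s2]) (chi t - psi t).
have A0 : 0 < A.
  apply: Rintegral_oc_gt0 => //.
    rewrite (_ : EFin \o _ = ((EFin \o chi) \- (EFin \o psi))%E)//.
    exact: integrableB.
  move=> t /andP[s0t ts2]; rewrite subr_gt0.
  exact: (tent_above psi_derive v_decreasing Ss0 s2T s0t ts2 apex s12).
have SsT : S < s0 < T by rewrite Ss0 (lt_trans s02).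
have Ss2T : S < s2 < T by rewrite s2T (lt_trans Ss0).
pose k (t : R) := if t <= s1 then w1 else w2.
pose k2 : R -> R := cst (w1 - w2) \_ `]-oo, s1].
have kE : k = fun t => w2 + k2 t.
  apply/funext => t; rewrite /k /k2 patchE mem_setE in_itv/=.
  by case: ifP => _; rewrite ?addr0//= addrC subrK.
have icst c : leb.-integrable `[0, 1] (EFin \o (fun=> c)).
  exact: integrable_itv_cst.
have ipatch : leb.-integrable `[0, 1] (EFin \o k2).
  rewrite /k2 -restrict_EFin; apply/integrable_restrict => //.
  apply: integrableS (icst (w1 - w2)) => //.
  by apply: measurableI; exact: measurable_itvR.
have ik : leb.-integrable `[0, 1] (EFin \o k).
  rewrite kE (_ : EFin \o _ = ((EFin \o (fun=> w2)) \+
    (EFin \o k2))%E)//.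
  exact: integrableD.
pose M := fine (I w1) + fine (I w2).
have M0 : 0 <= M by apply: addr_ge0; apply: fine_ge0.
have IkM t : (I (k t) <= M%:E)%E.
  rewrite /k /M EFinD -!v_fin//; case: ifP => _.
    by rewrite leeDl.
  by rewrite leeDr.
have mIk : measurable_fun ([set` `]s0, s2]] : borel) (fun t => I (k t)).
  apply: (measurableT_comp mI).
  have mk : measurable_fun ([set` `[0%R, 1%R]] : borel) k.
    by apply/measurable_EFinP; exact: measurable_int ik.
  by apply: measurable_funS mk.
have intk : (\int[leb]_(t in `]s0, s2]) I (k t) <= (M * (s2 - s0))%:E)%E.
  apply: (@le_trans _ _ (\int[leb]_(t in `]s0, s2]) (cst M%:E) t)%E).
    by apply: ge0_le_integral => //= t _; rewrite lee_fin.
  rewrite integral_cst// [X in (_ * X)%E]lebesgue_measure_itv/= lte_fin s02.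
  by rewrite -EFinB -EFinM.
exists A, (M * (s2 - s0)); split => //.
  by apply: mulr_ge0 => //; rewrite subr_ge0 ltW.
move=> tau sig y eps s2tau tau1 tsig psiy j0 /andP[a0 aA] eps0.
set a := Rintegral _ _ _ in a0 aA *.
have kap01 : 0 <= a / A <= 1.
  apply/andP; split; first by apply: divr_ge0 => //; exact: ltW.
  by rewrite ler_pdivrMr// mul1r.
have itail := integrable_tail tau sig y delta.
have tau0 : 0 < tau := le_lt_trans (le_trans s00 (ltW s02)) s2tau.
have subt : `[tau, 1]%classic `<=` `[0, 1]%classic.
  by apply: subset_itvr; rewrite bnd_simp ltW.
have aE : \int[leb]_(t in `[tau, 1]) (tail tau sig y delta t - psi t) = - a.
  by rewrite /a !RintegralB ?opprB//;
    [exact: integrableS ipsi|exact: integrableS itail|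
     exact: integrableS itail|exact: integrableS ipsi].
have j0' : 0 <= y - delta * (sig - tau) by rewrite j0.
have [||||g [mup [mdn [D fin le]]]] := @optimality_inequality R I thd thu
  I_ge0 mI rate_convex thd_ge0 thu_ge0 z psi psi_feasible psi_fin psi_min chi
  k s0 s2 (a / A) tau sig y delta eps s00 (ltW s02) s2tau tau1 tsig kap01
  ik ichi _ apex _ _ psiy rate_delta (ltW delta_gt0) j0' (or_intror j0) _ eps0.
- move=> u /andP[s0u us2].
  have sub0u : `]s0, u]%classic `<=` `[0, 1]%classic.
    by apply: subset_itv; rewrite bnd_simp// (le_trans us2).
  rewrite kE RintegralD//; [|exact: integrableS (icst _)|exact: integrableS ipatch].
  rewrite -Rintegral_mkcondr !Rintegral_cst//; last first.
    by apply: measurableI; exact: measurable_itvR.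
  have -> : [set` `]s0, u]] `&` [set` `]-oo, s1]] = [set` `]s0, Num.min u s1]] :> set R.
    apply/seteqP; split => x /=; rewrite !in_itv/= le_min.
      by move=> [/andP[-> ->] ->].
    by move=> /and3P[-> -> ->].
  have len r : s0 <= r -> fine (leb `]s0, r]) = r - s0.
    rewrite [X in fine X]lebesgue_measure_itv/= lte_fin le_eqVlt.
    by move=> /predU1P[->|->//]; rewrite ltxx subrr.
  rewrite !len//; last by rewrite le_min s0u ltW.
  by rewrite chiE; ring.
- by move=> u /andP[s0u us2]; apply: psi_gt0; apply/andP; split; lra.
- move=> u /andP[s0u]; rewrite le_eqVlt => /predU1P[->|us2].
    by rewrite [chi _]apex; exact/ltW/psi_gt0.
  apply: (@le_trans _ _ (psi u)).
    by apply/ltW/psi_gt0; apply/andP; split; lra.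
  exact/ltW/(tent_above psi_derive v_decreasing Ss0 s2T s0u us2 apex s12).
- by rewrite aE -/A mulfVK ?gt_eqF// subrr.
exists g, mup, mdn; split => //.
have cb : (0 <= (a / A)%:E * costI psi g mup mdn [set` `]s0, s2]])%E.
  by apply: mule_ge0; [rewrite lee_fin; case/andP: kap01|exact: cost_ge0].
apply: le_trans (leeDl _ cb) _; apply: le_trans le _.
rewrite j0 mule0 adde0 EFinD; apply: leeD => //.
by rewrite [leRHS]EFinM; apply: lee_wpmul2l => //; rewrite lee_fin; case/andP: kap01.
Qed.

(** A jump at [tau] is charged in full by every decomposition. *)
Lemma jump_cost g mup mdn tau y : decomposition psi g mup mdn ->
  0 < tau -> tau <= 1 -> psi s @[s --> tau^'-] --> y ->
  psi tau - y = fine (mup [set` `[tau, tau]]) - fine (mdn [set` `[tau, tau]]) /\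
  (thd * (fine (mdn [set` `[tau, tau]]))%:E +
    thu * (fine (mup [set` `[tau, tau]]))%:E <=
    costI psi g mup mdn [set` `[tau, 1%R]])%E.
Proof.
move=> D tau0 tau1 psiy; split.
  rewrite -(net_cc D tau0 (lexx _) tau1 psiy) /net set_itv1 Rintegral_set1.
  by rewrite add0r.
apply: (@le_trans _ _ (costI psi g mup mdn [set` `[tau, tau]])).
  rewrite /cost !fineK ?fin_num_measure//.
  rewrite -addeA leeDr//; apply: integral_ge0 => s _; exact: running_cost_ge0.
have mt : measurable ([set` `[tau, tau]] : borel) by exact: measurable_itvR.
apply: (cost_le I_ge0 mI thd_ge0 thu_ge0 D) => //.
  by apply: subset_itvr; rewrite bnd_simp ltW.
by apply: subset_itvl; rewrite bnd_simp.
Qed.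

(** A finite lower bound of both penalties, which may be infinite. *)
Lemma positive_penalty : exists2 c : R, 0 < c & (c%:E <= thd /\ c%:E <= thu)%E.
Proof.
have pos (x : \bar R) : (0 < x)%E -> exists2 c : R, 0 < c & (c%:E <= x)%E.
  case: x => [r r0| _|//]; first by exists r.
  by exists 1 => //; rewrite leey.
have [c c0 cd] := pos _ thd_gt0; have [c' c'0 cu] := pos _ thu_gt0.
exists (Num.min c c'); first by rewrite lt_min c0.
by rewrite EFin_min !ge_min cd cu orbT.
Qed.

Lemma psi_end : T < 1 -> psi T = 0.
Proof.
move=> T_lt1; have [[[cr _] _] _] := psi_feasible.1.
have T01 : 0 <= T < 1 by rewrite ltW.
have h0 : psi s @[s --> T^'+] --> (0 : R).
  apply: cvg_near_cst; near=> s; apply: psi_after.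
    by near: s; exact: nbhs_right_gt.
  by near: s; exact: nbhs_right_le.
exact: (cvg_unique (@norm_hausdorff _ R) (cr T T01) h0).
Unshelve. all: by end_near. Qed.

Lemma inner_window : exists s0 s2, [/\ S < s0, s0 < s2 & s2 < T].
Proof.
move: ST; move: S T => s t st.
by exists ((2 * s + t) / 3), ((s + 2 * t) / 3); split; lra.
Qed.

Lemma tail_ge0 tau sig y t : 0 <= y - delta * (sig - tau) ->
  0 <= tail tau sig y delta t.
Proof.
move=> j0; rewrite /tail patchE mem_setE in_itv/=; case: ifPn => // ts.
by apply: le_trans j0 _; rewrite lerD2l lerN2 ler_pM2l// lerD2r ltW.
Qed.

Lemma tail_le tau sig y t : tau <= t -> 0 <= y -> tail tau sig y delta t <= y.
Proof.
move=> tt y0; rewrite /tail patchE mem_setE in_itv/=; case: ifPn => // _.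
by rewrite gerBl mulr_ge0 ?subr_ge0// ltW.
Qed.

Lemma tail_after tau sig y t : sig <= t -> tail tau sig y delta t = 0.
Proof.
by move=> st; rewrite /tail patchE mem_setE in_itv/= ltNge st.
Qed.

Lemma descent_line_le0 tau sig y t : y - delta * (sig - tau) = 0 -> sig <= t ->
  y - delta * (t - tau) <= 0.
Proof. by move=> <- st; rewrite lerD2l lerN2 ler_pM2l// lerD2r. Qed.

Lemma integrable_tail_gap tau sig y : 0 < tau -> tau <= 1 ->
  leb.-integrable `[tau, 1] (EFin \o (fun t => tail tau sig y delta t - psi t)) /\
  leb.-integrable `[tau, 1] (EFin \o (fun t => psi t - tail tau sig y delta t)).
Proof.
move=> tau0 tau1.
have sub : `[tau, 1]%classic `<=` `[0, 1]%classic.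
  by apply: subset_itvr; rewrite bnd_simp ltW.
have ipsi := optimal_integrable I_ge0 thd_ge0 thu_ge0 psi_feasible psi_fin.
have ip : leb.-integrable `[tau, 1] (EFin \o psi).
  by apply: integrableS ipsi.
have it : leb.-integrable `[tau, 1] (EFin \o tail tau sig y delta).
  by apply: integrableS (integrable_tail tau sig y delta).
split.
  rewrite (_ : EFin \o _ = ((EFin \o tail tau sig y delta) \- (EFin \o psi))%E)//.
  exact: integrableB.
rewrite (_ : EFin \o _ = ((EFin \o psi) \- (EFin \o tail tau sig y delta))%E)//.
exact: integrableB.
Qed.

(** A jump at the final time changes no area, so removing it would be a pure
    gain. *)
Lemma no_jump_at_one y : T = 1 -> psi s @[s --> T^'-] --> y -> 0 <= y ->
  psi T = y.
Proof.
move=> T_eq1 psiy y0; apply/eqP/negPn/negP => /eqP ne.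
have [s0 [s2 [Ss0 s02 s2T]]] := inner_window.
have [A A0 chord] := chord_inequality Ss0 s02 s2T.
have [c c0 [cd cu]] := positive_penalty.
have gap : 0 < `|psi T - y| by rewrite normr_gt0 subr_eq0; apply/eqP.
have jE : y - delta * (T + y / delta - T) = 0.
  by field; rewrite gt_eqF.
have e0 : 0 < c * `|psi T - y| / 2 by rewrite divr_gt0// mulr_gt0.
(* here the tail is the single point [1], where it takes the left limit [y] *)
have [||||g [mup [mdn [D fin le]]]] :=
  chord T (T + y / delta) y _ s2T T_le1 _ psiy _ _ _ e0.
- by rewrite lerDl divr_ge0// ltW.
- by rewrite jE.
- by right.
- by rewrite -[in `[_, 1]]T_eq1 set_itv1 Rintegral_set1 lexx ltW.
have [je jc] := jump_cost D T_gt0 T_le1 psiy.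
move: je jc; set u := fine (mup _); set d := fine (mdn _) => je jc.
have u0 : 0 <= u by exact: fine_ge0.
have d0 : 0 <= d by exact: fine_ge0.
have : ((c * (d + u))%:E <= (c * `|psi T - y| / 2)%:E)%E.
  rewrite jE mule0 add0e in le; apply: le_trans le; apply: le_trans jc.
  rewrite mulrDr EFinD !EFinM; apply: leeD; exact: lee_wpmul2r.
rewrite lee_fin => {}le.
have ge : `|psi T - y| <= d + u.
  by rewrite je; apply: le_trans (ler_normB _ _) _; rewrite !ger0_norm// addrC.
have : c * `|psi T - y| <= c * `|psi T - y| / 2.
  by apply: le_trans le; rewrite ler_pM2l.
by rewrite leNgt ltr_pdivrMr// ltr_pMr ?ltr1n// mulr_gt0.
Qed.

(** A path that jumps down to zero at [T < 1] can descend freely at slope [- delta]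
    for a time [h] before jumping: this saves [delta * h] units of jump, and the
    area it adds is repaired for free by a chord. *)
Lemma no_jump_before_one y : T < 1 -> psi s @[s --> T^'-] --> y -> 0 <= y ->
  psi T = y.
Proof.
move=> T_lt1 psiy; rewrite (psi_end T_lt1) le_eqVlt => /predU1P[//|y0].
have [s0 [s2 [Ss0 s02 s2T]]] := inner_window.
have [A A0 chord] := chord_inequality Ss0 s02 s2T.
have [c c0 [cd cu]] := positive_penalty.
(* so that the descent ends before time 1, stays nonnegative, and adds an area
   of at most [A] *)
pose h := Num.min (Num.min (1 - T) (y / delta)) (A / y).
have h0 : 0 < h by rewrite !lt_min subr_gt0 T_lt1 !divr_gt0.
have h1 : h <= 1 - T by rewrite /h !ge_min lexx.
have hd : delta * h <= y.
  by rewrite mulrC -ler_pdivlMr// /h !ge_min lexx orbT.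
have hA : y * h <= A by rewrite mulrC -ler_pdivlMr// /h !ge_min lexx orbT.
(* less than the saving, which is at least [c * (delta * h)] *)
have e0 : 0 < c * (delta * h) / 2 by rewrite divr_gt0// !mulr_gt0.
have jE : T + h - T = h by rewrite addrC addKr.
have j0 : 0 <= y - delta * (T + h - T) by rewrite jE subr_ge0.
have psi0 t : T <= t -> t <= 1 -> psi t = 0.
  rewrite le_eqVlt => /predU1P[<- _|]; first exact: psi_end.
  exact: psi_after.
have [i1 i2] := integrable_tail_gap (T + h) y T_gt0 T_le1.
have [|||g [mup [mdn [D fin le]]]] :=
  chord T (T + h) y _ s2T T_le1 _ psiy j0 _ _ e0.
- by rewrite lerDl ltW.
- by left; rewrite -lerBrDl.
- apply/andP; split.
    apply: Rintegral_ge0 => t /=; rewrite in_itv/= => /andP[Tt t1].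
    by rewrite psi0// subr0 tail_ge0.
  apply: le_trans hA; rewrite -[X in _ <= y * X]jE.
  apply: Rintegral_head_le => //.
  + by rewrite lerDl ltW.
  + by rewrite -lerBrDl.
  + move=> t /andP[Tt th]; rewrite psi0// ?subr0 ?tail_le// ?(ltW y0)//.
    by apply: le_trans th _; rewrite -lerBrDl.
  + move=> t /andP[Tht t1]; rewrite tail_after ?(ltW Tht)// psi0 ?subrr//.
    by apply: le_trans (ltW Tht); rewrite lerDl ltW.
have [je jc] := jump_cost D T_gt0 T_le1 psiy.
move: je jc; set u := fine (mup _); set d := fine (mdn _) => je jc.
have u0 : 0 <= u by exact: fine_ge0.
have dy : y <= d by rewrite (psi_end T_lt1) in je; lra.
have d0 : 0 < d by exact: lt_le_trans dy.
have costT : (costI psi g mup mdn [set` `[T, 1%R]] < +oo)%E.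
  apply: le_lt_trans fin.
  by apply: (cost_le I_ge0 mI thd_ge0 thu_ge0 D) => //;
    apply: subset_itvr; rewrite bnd_simp ltW.
have thd_d : (thd * d%:E <= costI psi g mup mdn [set` `[T, 1%R]])%E.
  apply: le_trans jc; rewrite leeDl// mule_ge0//.
have thd_fin : thd \is a fin_num.
  rewrite ge0_fin_numE// ltey; apply/eqP => th.
  by move: (le_lt_trans thd_d costT); rewrite th gt0_mulye ?lte_fin// ltxx.
have := le_trans thd_d le; rewrite jE -(fineK thd_fin) -!EFinM -EFinD lee_fin.
have cth : c <= fine thd by rewrite -lee_fin fineK.
move=> le'.
have le1 : fine thd * y <= fine thd * d.
  by rewrite ler_pM2l//; exact: lt_le_trans cth.
have le2 : c * (delta * h) <= fine thd * (delta * h).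
  by rewrite ler_pM2r// mulr_gt0.
have dh : 0 < c * (delta * h) by rewrite !mulr_gt0.
exfalso; move: le' le1 le2 dh; rewrite mulrBr.
by move: (c * _) (fine thd * (delta * h)) => ? ? *; lra.
Qed.

Lemma endpoint_left_continuous : psi s @[s --> T^'-] --> psi T.
Proof.
have [|y [psiy y0 _]] := @left_limit T; first by rewrite T_gt0 T_le1.
suff -> : psi T = y by [].
move: T_le1; rewrite le_eqVlt => /predU1P[e|lt].
  exact: no_jump_at_one.
exact: no_jump_before_one.
Qed.

Lemma v_le_of_gradient_neg t : S < t < T -> b - lam * t < 0 -> v t <= - delta.
Proof.
move=> StT p0; have gr := v_gradient StT.
have := gradient_supporting_line I_ge0 rate_convex (- delta) gr.
rewrite rate_delta lee_fin => le.
have Iv : 0 <= fine (I (v t)) by exact: fine_ge0.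
by rewrite -subr_ge0 -(nmulr_rle0 _ p0); lra.
Qed.

Lemma v_ge_of_gradient_pos t : S < t < T -> 0 < b - lam * t -> - delta <= v t.
Proof.
move=> StT p0; have gr := v_gradient StT.
have := gradient_supporting_line I_ge0 rate_convex (- delta) gr.
rewrite rate_delta lee_fin => le.
have Iv : 0 <= fine (I (v t)) by exact: fine_ge0.
by rewrite -subr_le0 -(pmulr_rle0 _ p0); lra.
Qed.

(** If the gradient were negative at [T], the slopes before [T] would lie below
    [- delta] and be strictly expensive. The free descent of slope [- delta] lies
    above the path, and the area it adds tends to zero with [T - tau]: either
    [T = 1] or the path ends at zero. So the chord repair applies and the saving
    is a contradiction. *)
Lemma end_gradient_ge0 : 0 <= b - lam * T.
Proof.
rewrite leNgt; apply/negP => pT.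
have [s0 [s2 [Ss0 s02 s2T]]] := inner_window.
have [A A0 chord] := chord_inequality Ss0 s02 s2T.
have bT : b / lam < T by rewrite ltr_pdivrMr// mulrC -subr_lt0.
have end0 : psi s * (1 - s) @[s --> T^'-] --> (0 : R).
  have -> : 0 = psi T * (1 - T).
    move: T_le1; rewrite le_eqVlt => /predU1P[->|/psi_end ->].
      by rewrite subrr mulr0.
    by rewrite mul0r.
  apply: cvgM; first exact: endpoint_left_continuous.
  by apply: cvgB; [exact: cvg_cst|apply: cvg_at_left_filter; exact: cvg_id].
near T^'- => tau.
have tauT : tau < T by near: tau; exact: nbhs_left_lt.
have s2tau : s2 < tau by near: tau; exact: nbhs_left_gt.
have btau : b / lam < tau by near: tau; exact: nbhs_left_gt.
have small : psi tau * (1 - tau) < A.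
  by near: tau; apply: (cvgr_lt _ end0).
have neg t : tau <= t -> b - lam * t < 0.
  move=> tt; rewrite subr_lt0 mulrC -ltr_pdivrMr//.
  exact: lt_le_trans tt.
have Stau : S < tau by apply: lt_trans s2tau; exact: lt_trans Ss0 s02.
have StauT : S < tau < T by rewrite Stau.
have /andP[tau0 tau1] := range Stau tauT.
have tau_gt0 : 0 < tau by exact: le_lt_trans Stau.
have psiy : psi s @[s --> tau^'-] --> psi tau.
  by apply: cvg_at_left_filter; exact: (arc_continuous psi_derive).
have p0 : 0 < psi tau by exact: psi_gt0.
(* the time at which the descent reaches zero, possibly after time 1 *)
pose sig := tau + psi tau / delta.
have j0 : psi tau - delta * (sig - tau) = 0.
  by rewrite /sig; field; rewrite gt_eqF.
have [c /andP[tc cT] ce] :=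
  arc_mvt_end psi_derive endpoint_left_continuous Stau tauT.
have ScT : S < c < T by rewrite cT (lt_trans Stau).
have Ic : 0 < fine (I (v c)).
  have := gradient_supporting_line I_ge0 rate_convex (v c) (v_gradient StauT).
  rewrite (v_fin ScT) lee_fin; apply: lt_le_trans.
  apply: ltr_wpDl; first exact: fine_ge0.
  by rewrite nmulr_rgt0 ?neg// subr_lt0; exact: v_decreasing.
(* half of a lower bound on the cost saved after [tau] *)
have e0 : 0 < (T - tau) * fine (I (v c)) / 2.
  by rewrite divr_gt0// mulr_gt0// subr_gt0.
(* the slopes of [psi] after [tau] are at most [- delta] *)
have above t : tau <= t -> t <= 1 -> psi t <= tail tau sig (psi tau) delta t.
  move=> tt t1; have [Tt|tT] := ltP T t.
    by rewrite psi_after// tail_ge0// j0.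
  have lin : psi t <= psi tau - delta * (t - tau).
    move: tt; rewrite le_eqVlt => /predU1P[<-|tt].
      by rewrite subrr mulr0 subr0.
    have [d /andP[td dt] de] : exists2 d, tau < d < t &
        psi t - psi tau = v d * (t - tau).
      move: tT; rewrite le_eqVlt => /predU1P[->|tT].
        exact: (arc_mvt_end psi_derive endpoint_left_continuous).
      exact: (arc_mvt psi_derive).
    have vd : v d <= - delta.
      apply: v_le_of_gradient_neg; last by apply: neg; exact: ltW.
      by rewrite (lt_trans Stau td) (lt_le_trans dt tT).
    have : v d * (t - tau) <= - delta * (t - tau).
      by rewrite ler_pM2r// subr_gt0.
    by rewrite -de; lra.
  rewrite /tail patchE mem_setE in_itv/=; case: ltP => // st.
  exact: le_trans lin (descent_line_le0 j0 st).
have [i1 i2] := integrable_tail_gap sig (psi tau) tau_gt0 tau1.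
have [||||g [mup [mdn [D fin le]]]] :=
  chord tau sig (psi tau) _ s2tau tau1 _ psiy _ _ _ e0.
- by rewrite /sig lerDl divr_ge0// ltW.
- by rewrite j0.
- by right.
- apply/andP; split.
    apply: Rintegral_ge0 => t /=; rewrite in_itv/= => /andP[tt t1].
    by rewrite subr_ge0 above.
  apply: le_trans (ltW small); apply: Rintegral_head_le => //.
    move=> t /andP[tt t1]; rewrite lerBlDr.
    apply: le_trans (tail_le _ tt (ltW p0)) _.
    by rewrite lerDl psi_ge0// t1 (le_trans tau0 tt).
  by move=> t /andP[t1 /(lt_le_trans t1)]; rewrite ltxx.
move: le; rewrite j0 mule0 add0e; apply/negP; rewrite -ltNge.
apply: (@lt_le_trans _ _ ((T - tau) * fine (I (v c)))%:E).
  by rewrite lte_fin ltr_pdivrMr// ltr_pMr ?ltr1n// mulr_gt0// subr_gt0.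
apply: (@le_trans _ _ (costI psi g mup mdn [set` `]tau, T]])).
  apply: arc_cost D _ _ _ _ ScT ce => // u /andP[tu uT].
  by apply: psi_gt0; rewrite uT (lt_trans Stau).
apply: (cost_le I_ge0 mI thd_ge0 thu_ge0 D) => //.
  by apply: subset_itvr; rewrite bnd_simp.
by apply: subset_itv; rewrite bnd_simp.
Unshelve. all: by end_near. Qed.

Lemma v_gt_of_end_gradient t : S < t < T -> - delta < v t.
Proof.
move=> /andP[St tT]; pose t' := (t + T) / 2.
have tt' : t < t' by rewrite /t'; lra.
have t'T : t' < T by rewrite /t'; lra.
apply: le_lt_trans (v_decreasing St tt' t'T).
apply: v_ge_of_gradient_pos; first by rewrite (lt_trans St).
by apply: le_lt_trans end_gradient_ge0 _; rewrite ltrD2l ltrN2 ltr_pM2l.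
Qed.

(** If the slopes stay away from [- delta], the chord slope of the rate from
    [- delta] is bounded below because it is nondecreasing; if they do not, the
    supporting lines at slopes close to [- delta] have gradient at least
    [b - lam * T]. *)
Lemma rate_linear_growth : 0 < b - lam * T ->
  exists2 q, 0 < q & forall t, S < t < T -> q * (v t + delta) <= fine (I (v t)).
Proof.
move=> pT.
have [[u du uv]|none] := pselect (exists2 u, - delta < u &
    forall t, S < t < T -> u <= v t).
  have ratio t : S < t < T -> I u \is a fin_num /\
      fine (I u) / (u + delta) * (v t + delta) <= fine (I (v t)).
    move=> StT; apply: rate_ratio => //.
      exact: uv.
    by rewrite (v_fin StT).
  exists (fine (I u) / (u + delta)); last by move=> t /ratio[].
  have [s0 [s2 [Ss0 s02 s2T]]] := inner_window.
  have [|Iu _] := ratio s0; first by rewrite Ss0 (lt_trans s02).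
  have Iu0 := rate_gt0 I_ge0 rate_convex delta_gt0 rate_delta delta_least du.
  rewrite divr_gt0//; last by rewrite addrC -ltrBlDl sub0r.
  by rewrite -lte_fin fineK.
exists (b - lam * T) => // t StT; rewrite leNgt; apply/negP => lt.
(* a lower bound chosen so that the supporting line at a smaller slope already
   exceeds [I (v t)] at [v t] *)
apply: none; exists (v t - fine (I (v t)) / (b - lam * T)).
  rewrite ltrBrDl -ltrBrDr opprK ltr_pdivrMr// mulrC; exact: lt.
move=> t' St'T; rewrite leNgt; apply/negP => lt'.
have gr := v_gradient St'T.
have := gradient_supporting_line I_ge0 rate_convex (v t) gr.
rewrite (v_fin StT) lee_fin => le.
have I' : 0 <= fine (I (v t')) by exact: fine_ge0.
have vv : fine (I (v t)) < (b - lam * T) * (v t - v t').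
  by rewrite mulrC -ltr_pdivrMr// ltrBrDl -ltrBrDr.
have v0 : 0 < v t - v t'.
  by rewrite -(pmulr_rgt0 _ pT); apply: le_lt_trans vv; exact: fine_ge0.
have : (b - lam * T) * (v t - v t') <= (b - lam * t') * (v t - v t').
  rewrite ler_pM2r// lerD2l lerN2 ler_pM2l//.
  by case/andP: St'T => _ /ltW.
by lra.
Qed.

Lemma near_end_small (r e : R) : 0 < e -> \forall t \near T^'-, r * (T - t) < e.
Proof.
move=> e0; have h : r * (T - t) @[t --> T^'-] --> r * (T - T).
  apply: cvgM; first exact: cvg_cst.
  apply: cvgB; first exact: cvg_cst.
  by apply: cvg_at_left_filter; exact: cvg_id.
by rewrite subrr mulr0 in h; exact: (cvgr_lt _ h).
Qed.

(** If the gradient were positive at [T], the slopes would exceed [- delta]. The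
    free descent then lies below the path by at most
    [gap = (v c + delta) * (T - tau)], hence loses at most [gap * (T - tau)] of
    area, while it saves at least [q * gap] with [q] independent of [tau]. For
    [tau] close to [T] the saving exceeds the price of the repair by a tent. *)
Lemma end_gradient_le0 : b - lam * T <= 0.
Proof.
rewrite leNgt; apply/negP => pT.
have [q q0 growth] := rate_linear_growth pT.
have [s0 [s2 [Ss0 s02 s2T]]] := inner_window.
have Ss2 : S < s2 by exact: lt_trans Ss0 s02.
have [A [C [A0 C0 tent]]] := tent_inequality Ss0 s02 s2T.
have Ss2T : S < s2 < T by rewrite Ss2.
have v2 : 0 < v s2 + delta.
  by rewrite addrC -ltrBlDl sub0r; exact: v_gt_of_end_gradient.
near T^'- => tau.
have tauT : tau < T by near: tau; exact: nbhs_left_lt.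
have s2tau : s2 < tau by near: tau; exact: nbhs_left_gt.
have Stau : S < tau by apply: lt_trans s2tau.
have StauT : S < tau < T by rewrite Stau.
have small1 : (v s2 + delta) * (T - tau) < A by near: tau; exact: near_end_small.
have small2 : C * (T - tau) < q * A.
  by near: tau; apply: near_end_small; exact: mulr_gt0.
have /andP[tau0 tau1] := range Stau tauT.
have tau_gt0 : 0 < tau by exact: le_lt_trans Stau.
have psiy : psi s @[s --> tau^'-] --> psi tau.
  by apply: cvg_at_left_filter; exact: (arc_continuous psi_derive).
have p0 : 0 < psi tau by exact: psi_gt0.
(* the time at which the descent reaches zero, possibly after time 1 *)
pose sig := tau + psi tau / delta.
have j0 : psi tau - delta * (sig - tau) = 0.
  by rewrite /sig; field; rewrite gt_eqF.
have [c /andP[tc cT] ce] :=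
  arc_mvt_end psi_derive endpoint_left_continuous Stau tauT.
have ScT : S < c < T by rewrite cT (lt_trans Stau).
have slope s t : tau <= s -> s <= t -> t <= T -> - delta * (t - s) <= psi t - psi s.
  move=> ts; rewrite le_eqVlt => /predU1P[->|st tT].
    by rewrite !subrr mulr0.
  have Ss : S < s by exact: lt_le_trans ts.
  have [d /andP[sd dt] ->] : exists2 d, s < d < t & psi t - psi s = v d * (t - s).
    move: tT; rewrite le_eqVlt => /predU1P[e|tT].
      rewrite e in st *.
      exact: (arc_mvt_end psi_derive endpoint_left_continuous).
    exact: (arc_mvt psi_derive).
  rewrite ler_pM2r ?subr_gt0//; apply/ltW/v_gt_of_end_gradient.
  by rewrite (lt_trans Ss sd) (lt_le_trans dt tT).
pose gap := (v c + delta) * (T - tau).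
have gapE : gap = psi T - psi tau + delta * (T - tau) by rewrite ce /gap; ring.
have vc : 0 < v c + delta.
  by rewrite addrC -ltrBlDl sub0r; exact: v_gt_of_end_gradient.
have gap0 : 0 < gap by rewrite mulr_gt0// subr_gt0.
have tailE t : t < sig -> tail tau sig (psi tau) delta t = psi tau - delta * (t - tau).
  by move=> ts; rewrite /tail patchE mem_setE in_itv/= ts.
have below t : tau <= t -> t <= 1 -> tail tau sig (psi tau) delta t <= psi t.
  move=> tt t1; have t01 : 0 <= t <= 1 by rewrite t1 (le_trans tau0).
  have [ts|st] := ltP t sig; last by rewrite tail_after// psi_ge0.
  have [Tt|tT] := ltP T t; last first.
    by rewrite tailE//; have := slope tau t (lexx _) tt tT; lra.
  have psiT : psi T = 0 by apply: psi_end; exact: lt_le_trans t1.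
  have := slope tau T (lexx _) (ltW tauT) (lexx _); rewrite psiT => sl.
  have : delta * (T - tau) < delta * (sig - tau).
    by rewrite ltr_pM2l// ltrD2r; exact: lt_trans ts.
  by lra.
have upper t : tau <= t -> t <= T ->
    psi t - tail tau sig (psi tau) delta t <= gap.
  move=> tt tT; have := slope t T tt tT (lexx _); rewrite gapE.
  have [ts|st] := ltP t sig; first by rewrite tailE//; lra.
  by rewrite tail_after//; have := descent_line_le0 j0 st; lra.
have [i1 i2] := integrable_tail_gap sig (psi tau) tau_gt0 tau1.
pose a := \int[leb]_(t in `[tau, 1]) (psi t - tail tau sig (psi tau) delta t).
have a0 : 0 <= a.
  apply: Rintegral_ge0 => t /=; rewrite in_itv/= => /andP[tt t1].
  by rewrite subr_ge0 below.
have a_le : a <= gap * (T - tau).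
  apply: Rintegral_head_le => //.
    by move=> t /andP[]; exact: upper.
  move=> t /andP[Tt t1]; rewrite psi_after// sub0r oppr_le0.
  by apply: tail_ge0; rewrite j0.
have Ttau1 : T - tau <= 1 by rewrite lerBlDr (le_trans T_le1)// lerDl.
have aA : a <= A.
  apply: le_trans a_le (le_trans _ (ltW small1)).
  apply: (@le_trans _ _ gap).
    by rewrite -[leRHS]mulr1 ler_pM2l.
  rewrite ler_pM2r ?subr_gt0// lerD2r; apply/ltW/v_decreasing => //.
  exact: lt_trans tc.
(* half of the margin by which the saving exceeds the price of the repair *)
pose e := (q * gap - a / A * C) / 2.
have e0 : 0 < e.
  rewrite divr_gt0// subr_gt0; apply: (@le_lt_trans _ _ (gap * (T - tau) / A * C)).
    by rewrite ler_wpM2r// ler_pM2r// invr_gt0.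
  rewrite (_ : _ * C = gap * (C * (T - tau) / A)); last by ring.
  rewrite mulrC ltr_pM2r// ltr_pdivrMr//.
have [||g [mup [mdn [D le]]]] :=
  tent tau sig (psi tau) e s2tau tau1 _ psiy j0 _ e0.
- by rewrite /sig lerDl divr_ge0// ltW.
- by rewrite -/a a0.
move: le; rewrite -/a; apply/negP; rewrite -ltNge.
apply: (@lt_le_trans _ _ ((T - tau) * fine (I (v c)))%:E).
  rewrite lte_fin; apply: (@lt_le_trans _ _ (q * gap)).
    by rewrite /e; move: e0; rewrite /e; lra.
  rewrite /gap mulrA mulrC ler_pM2l ?subr_gt0//.
  exact: growth.
apply: (@le_trans _ _ (costI psi g mup mdn [set` `]tau, T]])).
  apply: arc_cost D _ _ _ _ ScT ce => // u /andP[tu uT].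
  by apply: psi_gt0; rewrite uT (lt_trans Stau).
apply: (cost_le I_ge0 mI thd_ge0 thu_ge0 D) => //.
  by apply: subset_itvr; rewrite bnd_simp.
by apply: subset_itv; rewrite bnd_simp.
Unshelve. all: by end_near. Qed.

Lemma gradient_intercept : b = lam * T.
Proof.
by apply/eqP; rewrite -subr_eq0 eq_le end_gradient_le0 end_gradient_ge0.
Qed.

(** Otherwise the supporting line at [v t], evaluated at [- delta], would keep the
    gradient [lam * (T - t)] above a positive constant. *)
Lemma slope_near_delta eta : 0 < eta ->
  exists2 t, S < t < T & v t < - delta + eta.
Proof.
move=> eta0; apply: contrapT => none.
have uv t : S < t < T -> - delta + eta <= v t.
  by move=> StT; rewrite leNgt; apply/negP => lt; apply: none; exists t.
have du : - delta < - delta + eta by rewrite ltrDl.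
have Iu0 := rate_gt0 I_ge0 rate_convex delta_gt0 rate_delta delta_least du.
pose u := - delta + eta.
have uE : u + delta = eta by rewrite /u; ring.
have key t : S < t < T -> 0 < fine (I u) /\ fine (I u) / eta <= lam * (T - t).
  move=> StT; have vd := v_gt_of_end_gradient StT.
  have [|Iu ratio] := @rate_ratio R I I_ge0 rate_convex delta rate_delta
    u (v t) du (uv _ StT); first by rewrite (v_fin StT).
  split; first by rewrite -lte_fin fineK.
  have := gradient_supporting_line I_ge0 rate_convex (- delta) (v_gradient StT).
  rewrite rate_delta lee_fin [in X in X - _]gradient_intercept -mulrBr => le.
  rewrite -(ler_pM2r (_ : 0 < v t + delta)); last first.
    by rewrite addrC -ltrBlDl sub0r.
  by move: ratio; rewrite uE; lra.
have [s0 [s2 [Ss0 s02 s2T]]] := inner_window.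
have [|Iu _] := key s0; first by rewrite Ss0 (lt_trans s02).
near T^'- => t.
have StT : S < t < T.
  apply/andP; split; last by near: t; exact: nbhs_left_lt.
  by near: t; exact: nbhs_left_gt.
have [_] := key t StT; apply/negP; rewrite -ltNge.
near: t; apply: near_end_small; exact: divr_gt0.
Unshelve. all: by end_near. Qed.

Lemma endpoint_left_derivative : is_left_derivative psi T (- delta).
Proof.
apply/cvgrPdist_lt => eta eta0.
have [t /andP[St tT] vt] := slope_near_delta eta0.
near=> h.
have h0 : h < 0 by near: h; exact: nbhs_left_lt.
have th : t < T + h.
  rewrite -ltrBlDl; near: h; apply: nbhs_left_gt.
  by rewrite subr_lt0.
have ThT : T + h < T by rewrite gtrDl.
have SThT : S < T + h by exact: lt_trans th.
have [c /andP[hc cT] ce] :=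
  arc_mvt_end psi_derive endpoint_left_continuous SThT ThT.
have -> : h^-1 * (psi (T + h) - psi T) = v c.
  rewrite -opprB ce; field; rewrite lt_eqF//.
have vc := @v_decreasing t c St (lt_trans th hc) cT.
have vd : - delta < v c.
  by apply: v_gt_of_end_gradient; rewrite cT (lt_trans SThT hc).
rewrite ltr_distl; apply/andP; split; lra.
Unshelve. all: by end_near. Qed.

End endpoint.

Theorem theorem6 (R : realType) (d : measure_display)
    (Omega : measurableType d) (P : probability Omega R)
    (X : nat -> {RV P >-> R}) (Lam : R -> \bar R) (delta : R)
    (* standing assumptions on the process *)
    (Lam_lim : forall theta : R,
      scaled_cgf X n theta @[n --> \oo] --> Lam theta)
    (theta_down_gt0 : (0 < theta_down Lam)%E)
    (theta_up_gt0 : (0 < theta_up Lam)%E)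
    (rate_good : good_rate_function (rate Lam))
    (rate_convex : convex_ereal (rate Lam))
    (delta_gt0 : 0 < delta)
    (rate_delta : rate Lam (- delta) = 0%E)
    (* which zero of the rate function delta is, in case there are several *)
    (delta_least : forall delta' : R, 0 < delta' ->
      rate Lam (- delta') = 0%E -> delta <= delta')
    (path_rate_good : good_rate_function (path_rate Lam))
    (LDP : satisfies_LDP P (scaled_path X) (path_rate Lam))
    (* the optimal path *)
    (z : R) (z_gt0 : 0 < z)
    (psi : R -> R) (psi_optimal : optimal Lam z psi)
    (T00_lt_T1 : T00 Lam psi < T1 psi)
    (b lam : R) (lam_gt0 : 0 < lam)
    (psi_affine_gradient : affine_gradient Lam psi b lam) :
  is_left_derivative psi (T1 psi) (- delta) /\ b = lam * T1 psi.
Proof.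
split.
  exact: (endpoint_left_derivative theta_down_gt0 theta_up_gt0 rate_good
    rate_convex delta_gt0 rate_delta delta_least psi_optimal T00_lt_T1 lam_gt0
    psi_affine_gradient).
exact: (gradient_intercept theta_down_gt0 theta_up_gt0 rate_good rate_convex
  delta_gt0 rate_delta delta_least psi_optimal T00_lt_T1 lam_gt0
  psi_affine_gradient).
Qed.
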